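(* The full opacity decision problem and the weak opacity decision problem are undecidable for timed automata with at least two clocks.
   Context: A timed automaton (TA) is a tuple $\mathcal{A}=(\Sigma,L,\ell_0,L_{priv},L_f,X,I,E)$ where $\Sigma$ is a finite set of actions, $L$ a finite set of locations, $\ell_0\in L$ the initial location, $L_{priv}\subseteq L$ the set of private locations, $L_f\subseteq L$ the set of final locations, $X$ a finite set of clocks, $I$ assigns to each location an invariant, and $E$ is a finite set of edges $(\ell,g,a,R,\ell')$ with $\ell,\ell'\in L$, $a\in\Sigma\cup\{\varepsilon\}$ (where $\varepsilon$ is an unobservable action), $R\subseteq X$ the set of clocks to reset, and $g$ a guard. Invariants and guards are conjunctions of constraints $x\bowtie d$ with $x\in X$, $d\in\mathbb{Z}$, ${\bowtie}\in\{<,\le,=,\ge,>\}$. A clock valuation is a map $\mu:X\to\mathbb{R}_{\ge0}$; a configuration is a pair $(\ell,\mu)$ with $\mu\models I(\ell)$; the initial configuration is $(\ell_0,\mathbf{0})$. A delay $d\ge0$ leads from $(\ell,\mu)$ to $(\ell,\mu+d)$ provided $\mu+d'\models I(\ell)$ for all $d'\in[0,d]$; an edge $(\ell,g,a,R,\ell')$ leads from $(\ell,\mu)$ to $(\ell',\mu')$ if $\mu\models g$, $\mu'$ is $\mu$ with the clocks of $R$ set to $0$, and $\mu'\models I(\ell')$. A run is a finite sequence $(\ell_0,\mu_0),(d_0,e_0),(\ell_1,\mu_1),\dots,(\ell_n,\mu_n)$ starting in the initial configuration, where each step is a delay $d_i$ followed by taking edge $e_i$, with $\ell_n\in L_f$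 and $\ell_i\notin L_f$ for $i<n$. A timed word is a finite sequence of pairs $(a,t)\in\Sigma\times\mathbb{R}_{\ge0}$ with non-decreasing timestamps. The trace of a run is the timed word consisting, in order, of the pairs $(a_i,\sum_{j\le i}d_j)$ for the edges $e_i$ whose action $a_i$ is not $\varepsilon$. A run is private if it visits some location of $L_{priv}$ and public otherwise; $\mathrm{PrivTr}(\mathcal{A})$ and $\mathrm{PubTr}(\mathcal{A})$ denote the sets of traces of private, resp. public, runs. $\mathcal{A}$ is weakly opaque if $\mathrm{PrivTr}(\mathcal{A})\subseteq\mathrm{PubTr}(\mathcal{A})$ and fully opaque if $\mathrm{PrivTr}(\mathcal{A})=\mathrm{PubTr}(\mathcal{A})$. The weak (resp. full) opacity decision problem asks, given a TA, whether it is weakly (resp. fully) opaque. *)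

(* Defs.v *)
From HB Require Import structures.
From mathcomp Require Import all_boot all_order all_algebra.
From mathcomp Require Import all_classical all_reals.

Set Implicit Arguments.
Unset Strict Implicit.
Unset Printing Implicit Defensive.

Import Order.TTheory GRing.Theory Num.Theory.

Local Open Scope classical_set_scope.
Local Open Scope ring_scope.

Variant cmp := CmpLt | CmpLe | CmpEq | CmpGe | CmpGt.

Definition nat_of_cmp (o : cmp) : nat :=
  match o with
  | CmpLt => 0 | CmpLe => 1 | CmpEq => 2 | CmpGe => 3 | CmpGt => 4
  end%N.

Definition cmp_of_nat (n : nat) : option cmp :=
  match n with
  | 0 => Some CmpLt | 1 => Some CmpLe | 2 => Some CmpEq
  | 3 => Some CmpGe | 4 => Some CmpGt | _ => None
  end%N.

Lemma nat_of_cmpK : pcancel nat_of_cmp cmp_of_nat.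
Proof. by case. Qed.

HB.instance Definition _ := Countable.copy cmp (pcan_type nat_of_cmpK).

(* The constraint (x, o, d) is x o d; a list of constraints is their
   conjunction. *)
Definition constraint (X : finType) : Type := (X * cmp * int)%type.
Definition guard (X : finType) : Type := seq (constraint X).

(* (l, g, a, r, l'), with a = None for the unobservable action. *)
Definition edge (Sigma L X : finType) : Type :=
  (L * guard X * option Sigma * {set X} * L)%type.

Record timed_automaton (Sigma L X : finType) := TimedAutomaton {
  ta_init : L;
  ta_priv : {set L};
  ta_final : {set L};
  ta_inv : {ffun L -> guard X};
  ta_edges : seq (edge Sigma L X)
}.

Section Semantics.

Context {R : realType} {Sigma L X : finType}.

Implicit Types (A : timed_automaton Sigma L X) (e : edge Sigma L X).

Definition edge_src e : L := let: (l, _, _, _, _) := e in l.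
Definition edge_guard e : guard X := let: (_, g, _, _, _) := e in g.
Definition edge_act e : option Sigma := let: (_, _, a, _, _) := e in a.
Definition edge_reset e : {set X} := let: (_, _, _, r, _) := e in r.
Definition edge_tgt e : L := let: (_, _, _, _, l) := e in l.

Definition valuation : Type := {ffun X -> R}.

Definition sat_cmp (o : cmp) (u v : R) : bool :=
  match o with
  | CmpLt => u < v
  | CmpLe => u <= v
  | CmpEq => u == v
  | CmpGe => u >= v
  | CmpGt => u > v
  end.

Definition sat (mu : valuation) (g : guard X) : bool :=
  all (fun c : constraint X => let: (x, o, d) := c in sat_cmp o (mu x) d%:~R) g.

Definition val0 : valuation := [ffun=> 0].
Definition val_delay (mu : valuation) (d : R) : valuation :=
  [ffun x => mu x + d].
Definition val_reset (mu : valuation) (r : {set X}) : valuation :=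
  [ffun x => if x \in r then 0 else mu x].

Definition config : Type := (L * valuation)%type.

Definition is_config A (c : config) : Prop :=
  (forall x, 0 <= c.2 x) /\ sat c.2 (ta_inv A c.1).

Definition init_config A : config := (ta_init A, val0).

Definition delay_step A (c : config) (d : R) (c' : config) : Prop :=
  [/\ 0 <= d,
      forall d', 0 <= d' <= d -> sat (val_delay c.2 d') (ta_inv A c.1)
    & c' = (c.1, val_delay c.2 d)].

Definition edge_step A (c : config) e (c' : config) : Prop :=
  [/\ e \in ta_edges A,
      edge_src e = c.1,
      sat c.2 (edge_guard e),
      c' = (edge_tgt e, val_reset c.2 (edge_reset e))
    & is_config A c'].

(* The step (d_i, e_i, c_(i+1)) of a run. *)
Definition run_step : Type := (R * edge Sigma L X * config)%type.

Fixpoint run_from A (c : config) (s : seq run_step) : Prop :=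
  match s with
  | [::] => c.1 \in ta_final A
  | (d, e, c') :: s' =>
      [/\ c.1 \notin ta_final A,
          exists2 c1, delay_step A c d c1 & edge_step A c1 e c'
        & run_from A c' s']
  end.

Definition is_run A (s : seq run_step) : Prop :=
  is_config A (init_config A) /\ run_from A (init_config A) s.

Definition visited A (s : seq run_step) : seq L :=
  ta_init A :: [seq st.2.1 | st <- s].

Definition private_run A (s : seq run_step) : bool :=
  has (fun l => l \in ta_priv A) (visited A s).

(* Monotonicity of timestamps is not part of the type: the only timed words
   considered are traces, and run delays are nonnegative. *)
Definition timed_word : Type := seq (Sigma * R).

Fixpoint trace_from (t : R) (s : seq run_step) : timed_word :=
  match s with
  | [::] => [::]
  | (d, e, _) :: s' =>
      if edge_act e is Some a then (a, t + d) :: trace_from (t + d) s'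
      else trace_from (t + d) s'
  end.

Definition trace (s : seq run_step) : timed_word := trace_from 0 s.

Definition PrivTr A : set timed_word :=
  [set w | exists s, [/\ is_run A s, private_run A s & trace s = w]].

Definition PubTr A : set timed_word :=
  [set w | exists s, [/\ is_run A s, ~~ private_run A s & trace s = w]].

End Semantics.

Definition weakly_opaque (R : realType) (Sigma L X : finType)
    (A : timed_automaton Sigma L X) : Prop :=
  @PrivTr R _ _ _ A `<=` @PubTr R _ _ _ A.

Definition fully_opaque (R : realType) (Sigma L X : finType)
    (A : timed_automaton Sigma L X) : Prop :=
  @PrivTr R _ _ _ A = @PubTr R _ _ _ A.

(* Partial recursive functions, indexed by arity. *)
Inductive recfun : nat -> Type :=
| RZero n : recfun n
| RSucc : recfun 1
| RProj n : 'I_n -> recfun n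
| RComp n m : recfun m -> ('I_m -> recfun n) -> recfun n
| RPrec n : recfun n -> recfun n.+2 -> recfun n.+1
| RMin n : recfun n.+1 -> recfun n.

(* f(0, v) = base(v), f(k+1, v) = step(k, f(k, v), v). *)
Fixpoint prec_graph (base : nat -> Prop) (step : nat -> nat -> nat -> Prop)
    (k y : nat) : Prop :=
  match k with
  | 0%N => base y
  | k'.+1 => exists2 z, prec_graph base step k' z & step k' z y
  end.

(* [recfun_eval f v y]: f is defined at v, with value y. *)
Fixpoint recfun_eval n (f : recfun n) : n.-tuple nat -> nat -> Prop :=
  match f in recfun n return n.-tuple nat -> nat -> Prop with
  | RZero _ => fun _ y => y = 0%N
  | RSucc => fun v y => y = (thead v).+1
  | RProj _ i => fun v y => y = tnth v i
  | RComp _ m g h => fun v y =>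
      exists2 w : m.-tuple nat,
        (forall i, recfun_eval (h i) v (tnth w i)) & recfun_eval g w y
  | RPrec n' g h => fun v y =>
      let p : n'.-tuple nat := [tuple of behead v] in
      prec_graph (recfun_eval g p)
        (fun k z => recfun_eval h [tuple of k :: z :: p]) (thead v) y
  | RMin _ g => fun v y =>
      recfun_eval g [tuple of y :: v] 0%N /\
      forall z, (z < y)%N -> exists u, recfun_eval g [tuple of z :: v] u.+1
  end.

(* A decision problem is given by its instances, their encoding as natural
   numbers, and the predicate asked about; a decider only has to answer on
   codes of instances. *)
Definition rec_decidable (T : Type) (code : T -> nat) (P : T -> Prop) : Prop :=
  exists f : recfun 1, forall x : T,
    (P x -> recfun_eval f [tuple code x] 1%N) /\
    (~ P x -> recfun_eval f [tuple code x] 0%N).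

Definition undecidable (T : Type) (code : T -> nat) (P : T -> Prop) : Prop :=
  ~ rec_decidable code P.

(* Finite presentations: actions, locations and clocks are numbered. *)
Record ta_instance (k : nat) := TAInstance {
  ta_nact : nat;
  ta_nloc : nat;
  ta_of :> timed_automaton 'I_ta_nact 'I_ta_nloc 'I_k
}.

Definition code_int (z : int) : nat :=
  match z with Posz n => n.*2 | Negz n => n.*2.+1 end.

Definition code_constraint k (c : constraint 'I_k) : nat :=
  let: (x, o, d) := c in CodeSeq.code [:: val x; nat_of_cmp o; code_int d].

Definition code_guard k (g : guard 'I_k) : nat :=
  CodeSeq.code (map (@code_constraint k) g).

Definition code_set n (B : {set 'I_n}) : nat :=
  CodeSeq.code (map val (enum B)).

Definition code_act n (a : option 'I_n) : nat :=
  if a is Some i then (val i).+1 else 0%N.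

Definition code_edge m n k (e : edge 'I_m 'I_n 'I_k) : nat :=
  let: (l, g, a, r, l') := e in
  CodeSeq.code [:: val l; code_guard g; code_act a; code_set r; val l'].

Definition code_ta k (A : ta_instance k) : nat :=
  CodeSeq.code [:: ta_nact A; ta_nloc A; k;
    val (ta_init A); code_set (ta_priv A); code_set (ta_final A);
    CodeSeq.code [seq code_guard (ta_inv A l) | l <- enum 'I_(ta_nloc A)];
    CodeSeq.code (map (@code_edge _ _ _) (ta_edges A))].

Lemma code_seq_inj : injective CodeSeq.code.
Proof. exact: can_inj CodeSeq.codeK. Qed.

Lemma code_int_inj : injective code_int.
Proof.
move=> [m|m] [n|n] /= E.
- by rewrite -(doubleK m) E doubleK.
- by have := congr1 odd E; rewrite /= !odd_double.
- by have := congr1 odd E; rewrite /= !odd_double.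
- by case: E => E; rewrite -(doubleK m) E doubleK.
Qed.

Lemma code_guard_inj k : injective (@code_guard k).
Proof.
move=> g g' /code_seq_inj; apply: inj_map => -[[x o] d] [[x' o'] d'].
by move=> /code_seq_inj[/val_inj-> /(pcan_inj nat_of_cmpK)-> /code_int_inj->].
Qed.

Lemma code_set_inj n : injective (@code_set n).
Proof.
move=> A B /code_seq_inj/(inj_map val_inj) E.
by apply/setP => x; rewrite -mem_enum E mem_enum.
Qed.

Lemma code_act_inj n : injective (@code_act n).
Proof. by case=> [i|] [j|] //= [/val_inj->]. Qed.

Lemma code_edge_inj m n k : injective (@code_edge m n k).
Proof.
move=> [[[[l g] a] r] l'] [[[[l1 g1] a1] r1] l1'] /code_seq_inj[].
by move=> /val_inj-> /code_guard_inj-> /code_act_inj-> /code_set_inj->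
  /val_inj->.
Qed.

Lemma code_ta_inj k : injective (@code_ta k).
Proof.
move=> [m n [i p f v e]] [m' n' [i' p' f' v' e']] /code_seq_inj /=.
case=> Em En; move: Em En i' p' f' v' e' => <- <- i' p' f' v' e'.
move=> /val_inj-> /code_set_inj-> /code_set_inj-> /code_seq_inj Ev.
move=> /code_seq_inj/(inj_map (@code_edge_inj _ _ _))->.
suff -> : v = v' by [].
apply/ffunP => l; apply: code_guard_inj.
by move/eq_in_map: Ev; apply; rewrite mem_enum.
Qed.

(* Main.v *)
Require Import Defs.
From mathcomp Require Import all_boot all_order all_algebra.
From mathcomp Require Import all_classical all_reals.
From mathcomp Require Import zify lra.

(** A timed automaton with two clocks reads a timed word as a space-time diagram
    of a register machine: a row of cells occupies one time unit, and the event
    at time t+1 is the cell below the event at time t.  The number of cells per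
    row is left to the word, so no cell is ever inserted, and being an accepting
    diagram is a matter of local constraints only: on consecutive events, on
    events at distance one, and on the row in which a letter may occur.  A
    nondeterministic automaton guesses where a constraint is violated; the two
    clocks are needed to detect an event that lies strictly between the copies
    of two consecutive events.  Public runs perform these checks while private
    runs read every timed word, hence each form of opacity holds exactly when the
    machine does not halt.

    The input z of the machine occurs only as a clock bound: during the first z
    rows a preamble increments the input register.  So a number X may serve both
    as the table of a machine and as its input, and the code of the resulting
    automaton is a primitive recursive function of X.  A decision procedure for
    opacity, composed with this function and compiled into a machine, would
    yield a machine that halts on its own table X iff it does not. *)

Set Implicit Arguments.
Unset Strict Implicit.
Unset Printing Implicit Defensive.

Import Order.TTheory GRing.Theory Num.Theory.

(** * Total recursive functions *)

(** [F] takes lists rather than tuples so that argument [i] reads [nth 0 v i] at every arity; only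
    the values on [n]-tuples matter. *)
Definition computable n (F : seq nat -> nat) : Prop :=
  exists f : recfun n, forall v : n.-tuple nat, recfun_eval f v (F v).

Lemma computable_ext n (F G : seq nat -> nat) :
  (forall v : n.-tuple nat, F v = G v) -> computable n F -> computable n G.
Proof. by move=> FG [f fP]; exists f => v; rewrite -FG. Qed.

Lemma computable_var n i : (i < n)%N -> computable n (fun v => nth 0 v i).
Proof.
by move=> lt_in; exists (RProj (Ordinal lt_in)) => v /=; rewrite (tnth_nth 0).
Qed.

Lemma computable_app m n G (Fs : seq (seq nat -> nat)) : size Fs = m ->
  computable m G -> (forall i, (i < m)%N -> computable n (nth (fun=> 0) Fs i)) ->
  computable n (fun v => G [seq F v | F <- Fs]).
Proof.
move=> sFs [g gP] FsP.
have /choice[h hP] : forall i : 'I_m, exists f : recfun n,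
    forall v : n.-tuple nat, recfun_eval f v (nth (fun=> 0) Fs i v).
  by move=> i; apply: FsP.
exists (RComp g h) => v /=.
have sw : size (map (fun F : seq nat -> nat => F v) Fs) == m by rewrite size_map sFs.
exists (Tuple sw); last exact: (gP (Tuple sw)).
move=> i; rewrite (tnth_nth 0) /= (nth_map (fun=> 0)) ?sFs //; exact: hP.
Qed.

Lemma computable_comp1 n (g : nat -> nat) F :
  computable 1 (fun v => g (nth 0 v 0)) -> computable n F ->
  computable n (fun v => g (F v)).
Proof.
by move=> gP FP; apply: (@computable_app _ _ _ [:: F] erefl gP); case.
Qed.

Lemma computable_comp2 n (g : nat -> nat -> nat) F G :
  computable 2 (fun v => g (nth 0 v 0) (nth 0 v 1)) ->
  computable n F -> computable n G -> computable n (fun v => g (F v) (G v)).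
Proof.
move=> gP FP GP; apply: (@computable_app _ _ _ [:: F; G] erefl gP).
by case=> [|[|[]]].
Qed.

Lemma computable_succ n F : computable n F -> computable n (fun v => (F v).+1).
Proof.
apply: (@computable_comp1 n succn).
by exists RSucc => v; rewrite /= [in LHS](tuple_eta v).
Qed.

Lemma computable_const n c : computable n (fun=> c).
Proof.
elim: c => [|c IHc]; first by exists (RZero n).
exact: (@computable_succ n (fun=> c)).
Qed.

Lemma computable_prec n B S : computable n B -> computable n.+2 S ->
  computable n.+1 (fun v => iteri (nth 0 v 0)
    (fun i z => S [:: i, z & behead v]) (B (behead v))).
Proof.
move=> [b bP] [s sP]; exists (RPrec b s) => v.
have -> : nth 0 v 0 = thead v by rewrite (tuple_eta v).
rewrite /=; elim: (thead v) => [|k IHk] /=; first exact: (bP [tuple of behead v]).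
by eexists; [exact: IHk | exact: (sP [tuple of _ :: _ :: behead v])].
Qed.

(** Primitive recursion in which the counter is any computable function of the arguments and the
    step still sees all of them. *)
Lemma computable_iteri n K B (S : nat -> nat -> seq nat -> nat)
    (F : seq nat -> nat) :
  computable n K -> computable n B ->
  computable n.+2 (fun w => S (nth 0 w 0) (nth 0 w 1) (drop 2 w)) ->
  (forall v : n.-tuple nat, iteri (K v) (fun i z => S i z v) (B v) = F v) ->
  computable n F.
Proof.
move=> KP BP SP FE.
apply: (@computable_ext n
  (fun v => iteri (K v) (fun i z => S i z v) (B v))) => //.
(* These functions together map [v] to [K v :: v], the argument list that [computable_prec]
   expects. *)
pose Fs : seq (seq nat -> nat) :=
  K :: [seq (fun v => nth 0 v i) | i <- iota 0 n].
have sFs : size Fs = n.+1 by rewrite /= size_map size_iota.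
have FsP i : i < n.+1 -> computable n (nth (fun=> 0) Fs i).
  case: i => [//|i] lt_in /=; rewrite (nth_map 0) ?size_iota // nth_iota //.
  exact: computable_var.
apply: computable_ext (computable_app sFs (computable_prec BP SP) FsP) => v /=.
have -> : map (fun F : seq nat -> nat => F v)
    [seq (nth 0)^~ i | i <- iota 0 n] = v.
  rewrite -map_comp -[RHS](mkseq_nth 0) size_tuple /mkseq.
  exact: eq_map.
by rewrite /= drop0.
Qed.

Lemma computable_add n F G : computable n F -> computable n G ->
  computable n (fun v => F v + G v)%N.
Proof.
move=> FP GP; apply: (@computable_iteri n G F (fun _ z _ => z.+1) _ GP FP).
  exact/computable_succ/computable_var.
by move=> v; elim: (G v) => [|k IHk]; rewrite ?addn0 //= IHk addnS.
Qed.

Lemma computable_mul n F G : computable n F -> computable n G ->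
  computable n (fun v => F v * G v)%N.
Proof.
apply: (@computable_comp2 n muln).
apply: (@computable_iteri 2 (fun v => nth 0 v 1) (fun=> 0)
  (fun _ z v => z + nth 0 v 0)%N).
- exact: computable_var.
- exact: computable_const.
- apply: computable_add; first exact: computable_var.
  by apply: (@computable_ext _ (fun w => nth 0 w 2));
     [move=> v; rewrite nth_drop|exact: computable_var].
move=> v; elim: (nth 0 v 1) => [|k IHk]; rewrite ?muln0 //=.
by rewrite IHk mulnS addnC.
Qed.

Lemma computable_exp n F G : computable n F -> computable n G ->
  computable n (fun v => F v ^ G v)%N.
Proof.
apply: (@computable_comp2 n expn).
apply: (@computable_iteri 2 (fun v => nth 0 v 1) (fun=> 1)
  (fun _ z v => z * nth 0 v 0)%N).
- exact: computable_var.
- exact: computable_const.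
- apply: computable_mul; first exact: computable_var.
  by apply: (@computable_ext _ (fun w => nth 0 w 2));
     [move=> v; rewrite nth_drop|exact: computable_var].
move=> v; elim: (nth 0 v 1) => [|k IHk]; rewrite ?expn0 //=.
by rewrite IHk expnSr.
Qed.

Lemma computable_pred n F : computable n F -> computable n (fun v => (F v).-1).
Proof.
apply: (@computable_comp1 n predn).
apply: (@computable_iteri 1 (fun v => nth 0 v 0) (fun=> 0) (fun i _ _ => i)).
- exact: computable_var.
- exact: computable_const.
- exact: computable_var.
by move=> v; case: (nth 0 v 0).
Qed.

Lemma computable_sub n F G : computable n F -> computable n G ->
  computable n (fun v => F v - G v)%N.
Proof.
move=> FP GP; apply: (@computable_iteri n G F (fun _ z _ => z.-1) _ GP FP).
  exact/computable_pred/computable_var.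
by move=> v; elim: (G v) => [|k IHk]; rewrite ?subn0 //= IHk subnS.
Qed.

Lemma computable_double n F : computable n F -> computable n (fun v => (F v).*2).
Proof.
move=> FP; apply: (@computable_ext _ (fun v => F v + F v)) => [v|].
  by rewrite addnn.
exact: computable_add.
Qed.

Lemma computable_leq n F G : computable n F -> computable n G ->
  computable n (fun v => F v <= G v : nat)%N.
Proof.
move=> FP GP.
apply: (@computable_ext _ (fun v => 1 - (F v - G v))%N) => [v|]; first by lia.
by do 2 ?apply: computable_sub => //; apply: computable_const.
Qed.

Lemma computable_neg n (b : seq nat -> bool) : computable n (fun v => b v) ->
  computable n (fun v => ~~ b v).
Proof.
move=> bP; apply: (@computable_ext _ (fun v => 1 - b v)%N) => [v|]; first by lia.
by apply: computable_sub => //; apply: computable_const.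
Qed.

Lemma computable_and n (b c : seq nat -> bool) :
  computable n (fun v => b v) -> computable n (fun v => c v) ->
  computable n (fun v => b v && c v).
Proof.
move=> bP cP; apply: (@computable_ext _ (fun v => b v * c v)%N) => [v|].
  by rewrite mulnb.
exact: computable_mul.
Qed.

Lemma computable_eq n F G : computable n F -> computable n G ->
  computable n (fun v => F v == G v).
Proof.
move=> FP GP; apply: (@computable_ext _ (fun v => (F v <= G v) && (G v <= F v))).
  by move=> v; rewrite -eqn_leq.
by apply: computable_and; apply: computable_leq.
Qed.

Lemma computable_if n (b : seq nat -> bool) F G : computable n (fun v => b v) ->
  computable n F -> computable n G ->
  computable n (fun v => if b v then F v else G v).
Proof.
move=> bP FP GP.
apply: (@computable_ext _ (fun v => b v * F v + (1 - b v) * G v)%N) => [v|].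
  by case: (b v); rewrite ?mul1n ?mul0n ?addn0.
apply: computable_add; apply: computable_mul => //.
by apply: computable_sub => //; apply: computable_const.
Qed.

(** Bounded search by counting: the values where [P] is true form an initial segment. This yields
    quotients and exponents of 2. *)
Lemma iteri_count (P : pred nat) q n : (forall i, i < n -> P i = (i < q)) ->
  iteri n (fun i z => z + P i)%N 0 = minn n q.
Proof.
elim: n => [|n IHn] Pq /=; first by rewrite min0n.
rewrite IHn => [|i lt_in]; last by apply: Pq; lia.
by rewrite Pq //; lia.
Qed.

Lemma computable_div n F G : computable n F -> computable n G ->
  computable n (fun v => F v %/ G v)%N.
Proof.
apply: (@computable_comp2 n divn).
(* The quotient counts the [i] with [i.+1 * d <= m]; the test [0 < d] gives the convention that
   division by 0 is 0. *)
apply: (@computable_iteri 2 (fun v => nth 0 v 0) (fun=> 0)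
  (fun i z v => z + ((0 < nth 0 v 1) && (i.+1 * nth 0 v 1 <= nth 0 v 0)))%N).
- exact: computable_var.
- exact: computable_const.
- apply: computable_add; first exact: computable_var.
  apply: (@computable_ext _ (fun w => (0 < nth 0 w 3) &&
      ((nth 0 w 0).+1 * nth 0 w 3 <= nth 0 w 2) : nat)).
    by move=> v; rewrite !nth_drop.
  apply: computable_and; apply: computable_leq.
  + exact: computable_const.
  + exact: computable_var.
  + by apply: computable_mul; [apply: computable_succ|]; exact: computable_var.
  + exact: computable_var.
move=> v; set m := nth 0 v 0; set d := nth 0 v 1.
case: (posnP d) => [->|d_gt0].
  by rewrite divn0 /=; elim: {m}(m) => [|k IHk] //=; rewrite IHk.
rewrite (@iteri_count _ (m %/ d)) => [|i _]; last by rewrite leq_divRL.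
by rewrite (minn_idPr _) // leq_div.
Qed.

Lemma computable_mod n F G : computable n F -> computable n G ->
  computable n (fun v => F v %% G v)%N.
Proof.
move=> FP GP.
apply: (@computable_ext _ (fun v => F v - F v %/ G v * G v)%N) => [v|].
  by rewrite {1}(divn_eq (F v) (G v)) addKn.
by apply: computable_sub => //; apply: computable_mul => //; apply: computable_div.
Qed.

(** The code of [a :: s] is [2 ^ a] times an odd number whose half is the code of [s]. So the head
    is the exponent of 2, counted by divisibility tests, and the tail is found by a division. *)
Definition code_head x : nat :=
  iteri x (fun i z => z + (x %% 2 ^ i.+1 == 0))%N 0.

Definition code_tail x : nat := (x %/ 2 ^ (code_head x).+1)%N.

Definition code_nth x i : nat := code_head (iteri i (fun _ => code_tail) x).

Lemma code_head_cons a s : code_head (CodeSeq.code (a :: s)) = a.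
Proof.
rewrite /=; set m := CodeSeq.code s; set x := (2 ^ a * _)%N.
have lt_ax : (a < x)%N.
  by apply: (leq_trans (ltn_expl a (ltnSn 1))); rewrite leq_pmulr.
rewrite /code_head (@iteri_count _ a) ?(minn_idPr _) ?(ltnW lt_ax) // => i _.
have -> : (x %% 2 ^ i.+1 == 0)%N = (2 ^ i.+1 %| x)%N by [].
case: (ltnP i a) => ia.
  by rewrite dvdn_mulr // dvdn_exp2l.
apply/negbTE/negP => /(dvdn_trans (dvdn_exp2l 2 (ia : a.+1 <= i.+1))).
by rewrite expnSr /x dvdn_pmul2l ?expn_gt0 // dvdn2 /= odd_double.
Qed.

Lemma code_tail_cons a s :
  code_tail (CodeSeq.code (a :: s)) = CodeSeq.code s.
Proof.
rewrite /code_tail code_head_cons /=; set m := CodeSeq.code s.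
rewrite expnSr divnMA mulKn ?expn_gt0 // divn2 -addn1 addnC.
by rewrite -[(1 + _)%N]/((true + m.*2)%N) half_bit_double.
Qed.

Lemma code_nthE s i : (i < size s)%N -> code_nth (CodeSeq.code s) i = nth 0 s i.
Proof.
have iter_tail x j : iteri j.+1 (fun _ => code_tail) x =
    iteri j (fun _ => code_tail) (code_tail x).
  by elim: j => //= j ->.
rewrite /code_nth; elim: i s => [|i IHi] [|a s] // lt_is.
  exact: code_head_cons.
by rewrite iter_tail code_tail_cons IHi.
Qed.

Lemma computable_code_head n F : computable n F ->
  computable n (fun v => code_head (F v)).
Proof.
apply: (@computable_comp1 n code_head).
apply: (@computable_iteri 1 (fun v => nth 0 v 0) (fun=> 0)
  (fun i z v => z + (nth 0 v 0 %% 2 ^ i.+1 == 0))%N).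
- exact: computable_var.
- exact: computable_const.
- apply: computable_add; first exact: computable_var.
  apply: (@computable_ext _ (fun w => nth 0 w 2 %% 2 ^ (nth 0 w 0).+1 == 0)%N).
    by move=> v; rewrite nth_drop.
  apply: computable_eq; last exact: computable_const.
  apply: computable_mod; first exact: computable_var.
  apply: computable_exp; first exact: computable_const.
  exact/computable_succ/computable_var.
by [].
Qed.

Lemma computable_code_nth n F G : computable n F -> computable n G ->
  computable n (fun v => code_nth (F v) (G v)).
Proof.
move=> FP GP; apply: computable_code_head.
apply: (@computable_iteri n G F (fun _ z _ => code_tail z)) => //.
apply: computable_div; first exact: computable_var.
apply: computable_exp; first exact: computable_const.
exact/computable_succ/computable_code_head/computable_var.
Qed.

Lemma computable_code_cons n F G : computable n F -> computable n G ->
  computable n (fun v => 2 ^ F v * (G v).*2.+1)%N.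
Proof.
move=> FP GP; apply: computable_mul.
  by apply: computable_exp => //; apply: computable_const.
exact/computable_succ/computable_double.
Qed.

(** * Compiling recursive functions to register machines *)

Definition store := nat -> nat.

Definition upd (s : store) r y : store := fun r' => if r' == r then y else s r'.

(* Register 0 stands for an inexhaustible supply of tokens, whose content is
   not tracked. *)
Definition transfer (r1 r2 : nat) (s : store) : store :=
  fun r => if r == 0 then s r else s r - (r == r1) + (r == r2).

Inductive cmd := Skip | Inc of nat | Seq of cmd & cmd | Loop of nat & cmd.

Inductive exec : cmd -> store -> store -> Prop :=
| ExecSkip s : exec Skip s s
| ExecInc r s : exec (Inc r) s (transfer 0 r s)
| ExecSeq c1 c2 s1 s2 s3 : exec c1 s1 s2 -> exec c2 s2 s3 ->
    exec (Seq c1 c2) s1 s3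
| ExecLoop0 r c s : r != 0 -> s r = 0 -> exec (Loop r c) s s
| ExecLoopS r c s1 s2 s3 : r != 0 -> 0 < s1 r -> exec c (transfer r 0 s1) s2 ->
    exec (Loop r c) s2 s3 -> exec (Loop r c) s1 s3.

(** Countdown loops: [S i] is the store with [i] rounds to go, and the body leaves the counter [r]
    as it finds it. *)
Lemma exec_loop r c (S : nat -> store) n : r != 0 ->
  (forall i, i <= n -> S i r = i) ->
  (forall i, i < n -> exec c (transfer r 0 (S i.+1)) (S i)) ->
  exec (Loop r c) (S n) (S 0).
Proof.
move=> r_neq0; elim: n => [|n IHn] Sr Sc.
  by apply: ExecLoop0 => //; apply: Sr.
apply: (@ExecLoopS _ _ _ (S n)) => //; first by rewrite Sr.
  exact: Sc.
by apply: IHn => i le_in; [apply: Sr|apply: Sc]; lia.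
Qed.

Ltac store_eq := apply/funext => ?; rewrite /upd /transfer /=;
  repeat (case: eqP => ? /=); subst; try done; try lia.

Ltac store_case := repeat (case: eqP => ? /=); try done; lia.

Lemma exec_eq c s1 s2 s3 : exec c s1 s2 -> s2 = s3 -> exec c s1 s3.
Proof. by move=> + <-. Qed.

Lemma exec_clear r s : r != 0 -> exec (Loop r Skip) s (upd s r 0).
Proof.
move=> r0; have := @exec_loop r Skip (fun i => upd s r i) (s r) r0.
have -> : upd s r (s r) = s by store_eq.
apply=> [i _|i _]; first by rewrite /upd eqxx.
apply: exec_eq; [exact: ExecSkip|store_eq].
Qed.

Lemma exec_move r t s : r != 0 -> t != 0 -> r != t ->
  exec (Loop r (Inc t)) s (upd (upd s t (s t + s r)) r 0).
Proof.
move=> r0 t0 rt.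
have := @exec_loop r (Inc t) (fun i => upd (upd s t (s t + (s r - i))) r i) (s r) r0.
rewrite subnn subn0.
have -> : upd (upd s t (s t + 0)) r (s r) = s by store_eq.
apply=> [i _|i lt_i]; first by rewrite /upd eqxx.
apply: exec_eq; [exact: ExecInc|store_eq].
Qed.

Definition copy r t tmp := Seq (Loop r (Seq (Inc t) (Inc tmp))) (Loop tmp (Inc r)).

Lemma exec_copy r t tmp s : r != 0 -> t != 0 -> tmp != 0 ->
  r != t -> r != tmp -> t != tmp -> s tmp = 0 ->
  exec (copy r t tmp) s (upd s t (s t + s r)).
Proof.
move=> r0 t0 tmp0 rt rtmp ttmp s_tmp.
have := @exec_loop r (Seq (Inc t) (Inc tmp)) (fun i =>
  upd (upd (upd s t (s t + (s r - i))) tmp (s r - i)) r i) (s r) r0.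
rewrite subnn subn0.
have -> : upd (upd (upd s t (s t + 0)) tmp 0) r (s r) = s by store_eq.
move=> h; apply: ExecSeq.
  apply: h => [i _|i lt_i]; first by rewrite /upd eqxx.
  by apply: ExecSeq (ExecInc _ _) _; apply: exec_eq (ExecInc _ _) _; store_eq.
by apply: exec_eq (exec_move _ _ _ _) _ => //; [rewrite eq_sym|store_eq].
Qed.

Definition seqs := foldr Seq Skip.

Lemma exec_seqs cs (S : nat -> store) :
  (forall j, j < size cs -> exec (nth Skip cs j) (S j) (S j.+1)) ->
  exec (seqs cs) (S 0) (S (size cs)).
Proof.
elim: cs S => [|c cs IH] S Sj; first exact: ExecSkip.
apply: (ExecSeq (Sj 0 _)) => //.
by apply: (IH (S \o succn)) => j lt_j; apply: (Sj j.+1).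
Qed.

(** Calling convention: arguments stand in [ins], the value is added to [out], and registers from
    [b] on are scratch. In a recursion [b] counts the rounds left, [b.+1] is the index, [b.+2] the
    current value and [b.+3] the next one. In a minimization [b] is the candidate and [b.+1] the
    value of [g] there. *)
Fixpoint rcomp n (f : recfun n) (ins : seq nat) (out b : nat) : cmd :=
  match f with
  | RZero _ => Skip
  | RSucc => Seq (copy (nth 0 ins 0) out b) (Inc out)
  | RProj _ i => copy (nth 0 ins i) out b
  | RComp _ m g h =>
      Seq (seqs [seq rcomp (h i) ins (b + i) (b + m) | i <- enum 'I_m])
     (Seq (rcomp g (iota b m) out (b + m))
          (seqs [seq Loop r Skip | r <- iota b m]))
  | RPrec _ g h =>
      Seq (copy (nth 0 ins 0) b b.+1)
     (Seq (rcomp g (behead ins) b.+2 b.+4)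
     (Seq (Loop b (Seq (rcomp h [:: b.+1, b.+2 & behead ins] b.+3 b.+4)
                  (Seq (Loop b.+2 Skip)
                  (Seq (Loop b.+3 (Inc b.+2))
                       (Inc b.+1)))))
     (Seq (Loop b.+2 (Inc out))
          (Loop b.+1 Skip))))
  | RMin _ g =>
      Seq (rcomp g (b :: ins) b.+1 b.+2)
     (Seq (Loop b.+1 (Seq (Loop b.+1 Skip)
                     (Seq (Inc b) (rcomp g (b :: ins) b.+1 b.+2))))
          (Loop b (Inc out)))
  end.

Lemma prec_graphP base step k y : prec_graph base step k y ->
  exists z : nat -> nat,
    [/\ base (z 0), forall i, i < k -> step i (z i) (z i.+1) & z k = y].
Proof.
elim: k y => [|k IHk] y /=; first by exists (fun=> y).
move=> [z' /IHk[z [z0 zS zk]] step_y].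
exists (fun i => if i == k.+1 then y else z i); split=> //; last by rewrite eqxx.
move=> i; rewrite ltnS => le_ik.
have -> : (i == k.+1) = false by lia.
rewrite eqSS; case: eqP => [->|ik]; first by rewrite zk.
by apply: zS; lia.
Qed.

Lemma rcompP n (f : recfun n) (v : n.-tuple nat) y ins out b (s : store) :
  recfun_eval f v y -> val v = map s ins ->
  all (fun r => 0 < r < b) ins -> 0 < out < b -> out \notin ins ->
  (forall r, b <= r -> s r = 0) ->
  exec (rcomp f ins out b) s (upd s out (s out + y)).
Proof.
elim: f v y ins out b s => {n}.
- move=> n v y ins out b s /= -> _ _ _ _ _.
  by apply: exec_eq (ExecSkip _) _; store_eq.
- move=> v y [|r [|? ?]] out b s /= yE vE; try by have := size_tuple v; rewrite vE.
  rewrite inE andbT => rb ob ro sb.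
  have {yE vE} yE : y = (s r).+1.
    by rewrite yE; move: vE; rewrite {1}(tuple_eta v) => -[->].
  apply: ExecSeq; first by apply: exec_copy; rewrite ?sb //; lia.
  by apply: exec_eq (ExecInc _ _) _; store_eq.
- move=> n i v y ins out b s /= yE vE ib ob oi sb.
  have si : i < size ins.
    by have := congr1 size vE; rewrite size_tuple size_map => <-.
  have {yE} -> : y = s (nth 0 ins i).
    by rewrite yE (tnth_nth 0) vE (nth_map 0).
  have ri : nth 0 ins i \in ins by apply: mem_nth.
  have /andP[r0 rb] := allP ib _ ri.
  have ro : nth 0 ins i != out by apply: contraNneq oi => <-.
  by apply: exec_copy; rewrite ?sb //; lia.
- move=> n m g IHg h IHh v y ins out b s /= [w hw gw] vE ib ob oi sb.
  (* The store once the first [j] inner functions have been evaluated. *)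
  pose S j : store := fun r => if b <= r < b + j then nth 0 w (r - b) else s r.
  have Sins j : map (S j) ins = map s ins.
    by apply/eq_in_map => r /(allP ib) rb; rewrite /S; case: ifP => //; lia.
  apply: (@ExecSeq _ _ _ (S m)).
    have -> : s = S 0.
      by apply/funext => r; rewrite /S; case: ifP => //; lia.
    set cs := map _ _; have scs : size cs = m by rewrite size_map size_enum_ord.
    have := @exec_seqs cs S; rewrite scs; apply => j lt_jm.
    rewrite (nth_map (Ordinal lt_jm)) ?size_enum_ord //.
    rewrite (nth_ord_enum _ (Ordinal lt_jm)).
    apply: exec_eq (IHh (Ordinal lt_jm) v _ _ _ _ _ (hw _) _ _ _ _ _) _ => /=.
    + by rewrite Sins.
    + by apply: sub_all ib => r; lia.
    + by lia.
    + by apply/negP => /(allP ib); lia.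
    + by move=> r br; rewrite /S; case: ifP; [lia|move=> _; apply: sb; lia].
    + apply/funext => r; rewrite /upd /S (tnth_nth 0) /=.
      case: (eqVneq r (b + j)) => [->|rj].
        rewrite ltnn andbF addKn; case: ifP; last lia.
        by rewrite sb //; lia.
      by congr (if _ then _ else _); lia.
  apply: (@ExecSeq _ _ _ (upd (S m) out (S m out + y))).
    apply: (IHg w) => //.
    + apply: (@eq_from_nth _ 0); first by rewrite size_tuple size_map size_iota.
      move=> i; rewrite size_tuple => im.
      rewrite (nth_map 0) ?size_iota // nth_iota // /S addKn.
      by case: ifP => //; lia.
    + by apply/allP => r; rewrite mem_iota; lia.
    + by lia.
    + by rewrite mem_iota; lia.
    + by move=> r br; rewrite /S; case: ifP; [lia|move=> _; apply: sb; lia].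
  (* The store during the final clearing, with the first [j] intermediate values erased. *)
  pose S' j : store := fun r => if b + j <= r < b + m then nth 0 w (r - b)
                                else upd s out (s out + y) r.
  have -> : upd (S m) out (S m out + y) = S' 0.
    apply/funext => r; rewrite /S' /upd /S addn0.
    have -> : b <= out < b + m = false by lia.
    by case: (eqVneq r out) => [->|//]; case: ifP => //; lia.
  have -> : upd s out (s out + y) = S' m.
    by apply/funext => r; rewrite /S'; case: ifP => //; lia.
  set cs := map _ _; have scs : size cs = m by rewrite size_map size_iota.
  have := @exec_seqs cs S'; rewrite scs; apply => j lt_jm.
  rewrite (nth_map 0) ?size_iota // nth_iota //.
  apply: exec_eq (exec_clear _ _) _; first lia.
  apply/funext => r; rewrite /S' /upd; case: (eqVneq r (b + j)) => [->|rj].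
    rewrite addnS ltnn /=; case: eqP; first lia.
    by rewrite sb //=; lia.
  by congr (if _ then _ else _); lia.
- move=> n g IHg h IHh v y [|k ins] out b s /=.
    by have := size_tuple v => + _ vE; rewrite vE.
  move=> /prec_graphP[z [z0 zS zk]] vE /andP[kb ib] ob.
  rewrite inE negb_or => /andP[ok oi] sb.
  have [vk vi] : thead v = s k /\ behead v = map s ins.
    by move: vE; rewrite {1}(tuple_eta v) => -[-> <-]; rewrite (tuple_eta v).
  rewrite vk in zS zk.
  have inb r : r \in ins -> 0 < r < b by move/(allP ib).
  have nin r : b <= r -> r \notin ins by move=> br; apply/negP => /inb; lia.
  have [sb0 sb1 sb2 sb3] : [/\ s b = 0, s b.+1 = 0, s b.+2 = 0 & s b.+3 = 0].
    by split; apply: sb; lia.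
  (* The loop invariant with [j] rounds left, hence [s k - j] rounds done. *)
  pose S j : store := upd (upd (upd s b j) b.+1 (s k - j)) b.+2 (z (s k - j)).
  apply: ExecSeq; first by apply: exec_copy; rewrite ?sb //; lia.
  apply: (@ExecSeq _ _ _ (S (s k))).
    apply: exec_eq (IHg _ _ _ _ _ _ z0 _ _ _ _ _) _ => //=.
    + rewrite vi; apply/eq_in_map => r /inb rb.
      by rewrite /upd; case: eqP => //; lia.
    + by apply: sub_all ib => r; lia.
    + by apply: nin; lia.
    + by move=> r br; rewrite /upd; case: eqP; [lia|move=> _; apply: sb; lia].
    + by rewrite /S subnn; store_eq.
  apply: (@ExecSeq _ _ _ (S 0)).
    apply: exec_loop => [|i|i]; first lia.
      move=> le_i; by rewrite /S /upd; store_case.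
    move=> lt_i; pose d := s k - i.+1.
    have dE : s k - i = d.+1 by rewrite /d; lia.
    have di : d < s k by rewrite /d; lia.
    apply: ExecSeq.
      apply: (IHh _ _ _ _ _ _ (zS d di)) => //=.
      + rewrite vi; congr [:: _, _ & _].
        * by rewrite /transfer /S /upd /= -/d; store_case.
        * by rewrite /transfer /S /upd /= -/d; store_case.
        * apply/eq_in_map => r /inb rb.
          by rewrite /transfer /S /upd /=; store_case.
      + by apply/and3P; split; [lia|lia|apply: sub_all ib => r; lia].
      + by rewrite !inE !negb_or nin; lia.
      + move=> r br; rewrite /transfer /S /upd /=.
        by rewrite (sb r); [store_case|lia].
    apply: ExecSeq; first exact: exec_clear.
    apply: ExecSeq; first by apply: exec_move; lia.
    apply: exec_eq (ExecInc _ _) _.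
    by rewrite /S dE -/d; store_eq.
  apply: ExecSeq; first by apply: exec_move; lia.
  apply: exec_eq (exec_clear _ _) _; first by [].
  by rewrite /S subn0 zk; store_eq.
- move=> n g IHg v y ins out b s /= [gy gz] vE ib ob oi sb.
  have inb r : r \in ins -> 0 < r < b by move/(allP ib).
  have nin r : b <= r -> r \notin ins by move=> br; apply/negP => /inb; lia.
  have [sb0 sb1] : [/\ s b = 0 & s b.+1 = 0].
    by split; apply: sb; lia.
  (* [u i] is the value of [g] at the candidate [i]. *)
  have [u uP] : exists u : nat -> nat, u y = 0 /\
      forall i, i <= y -> recfun_eval g (cons_tuple i v) (u i) /\
        (i < y -> 0 < u i).
    have /choice[u uP] : forall i, exists w, i < y ->
        recfun_eval g (cons_tuple i v) w.+1.
      move=> i; case: (ltnP i y) => iy; last by exists 0.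
      by have [w] := gz i iy; exists w.
    exists (fun i => if i == y then 0 else (u i).+1); rewrite eqxx; split=> //.
    move=> i le_iy; case: eqP => [->|iy]; first by rewrite ltnn.
    by split=> //; apply: uP; lia.
  have {}gP (s1 : store) i : i <= y -> s1 b = i ->
      (forall r, r < b -> s1 r = s r) -> (forall r, b < r -> s1 r = 0) ->
      exec (rcomp g (b :: ins) b.+1 b.+2) s1 (upd s1 b.+1 (u i)).
    move=> iy s1b s1s s10.
    apply: exec_eq (IHg _ _ _ _ _ _ (uP.2 i iy).1 _ _ _ _ _) _ => //=.
    + by rewrite s1b vE; congr (_ :: _); apply/eq_in_map => r /inb rb; rewrite s1s; lia.
    + by apply/andP; split; [lia|apply: sub_all ib => r; lia].
    + by rewrite inE negb_or nin; lia.
    + by move=> r br; apply: s10; lia.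
    + by store_eq; rewrite s10.
  pose Q i : store := upd (upd s b i) b.+1 (u i).
  apply: (@ExecSeq _ _ _ (Q 0)).
    apply: exec_eq (gP s 0 _ _ _ _) _ => //.
      by move=> r br; apply: sb; lia.
    by rewrite /Q; store_eq.
  apply: (@ExecSeq _ _ _ (Q y)).
    (* Each round overwrites the tested register [b.+1], so this is no countdown loop; the induction
       is on the distance from the candidate to [y]. *)
    suff loopQ d i : i + d = y -> exec (Loop b.+1 (Seq (Loop b.+1 Skip)
        (Seq (Inc b) (rcomp g (b :: ins) b.+1 b.+2)))) (Q i) (Q y).
      exact: (loopQ y).
    elim: d i => [|d IHd] i iE.
      have -> : i = y by lia.
      by apply: ExecLoop0 => //; rewrite /Q /upd eqxx uP.1.
    apply: (@ExecLoopS _ _ _ (Q i.+1)) => //.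
    + by rewrite /Q /upd eqxx; apply: (uP.2 i _).2; lia.
    + apply: ExecSeq; first exact: exec_clear.
      apply: ExecSeq; first exact: ExecInc.
      apply: exec_eq (gP _ i.+1 _ _ _ _) _; first lia.
      * by rewrite /Q /upd /transfer; store_case.
      * by move=> r rb; rewrite /Q /upd /transfer; store_case.
      * move=> r rb; rewrite /Q /upd /transfer.
        by rewrite (sb r); [store_case|lia].
      * by rewrite /Q; store_eq.
    by apply: IHd; lia.
  apply: exec_eq (exec_move _ _ _ _) _; try lia.
  by rewrite /Q uP.1; store_eq.
Qed.

(** * Compilation of commands to instruction tables *)

Definition instr : Type := (nat * nat * nat * nat)%type.

Definition mstep (P : nat -> instr) (c : nat * store) : nat * store :=
  let: (r1, r2, j1, j0) := P c.1 in
  if (r1 == 0) || (0 < c.2 r1) then (j1, transfer r1 r2 c.2) else (j0, c.2).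

Fixpoint csize c : nat :=
  match c with
  | Seq c1 c2 => csize c1 + csize c2
  | Loop _ c => (csize c).+1
  | _ => 1
  end.

(* Code for [c] at address [a], leaving to address [e]. *)
Fixpoint flat c a e : seq instr :=
  match c with
  | Skip => [:: (0, 0, e, e)]
  | Inc r => [:: (0, r, e, e)]
  | Seq c1 c2 => flat c1 a (a + csize c1) ++ flat c2 (a + csize c1) e
  | Loop r c => (r, 0, a.+1, e) :: flat c a.+1 a
  end.

Lemma size_flat c a e : size (flat c a e) = csize c.
Proof.
elim: c a e => //= [c1 IH1 c2 IH2|r c IH] a e; last by rewrite IH.
by rewrite size_cat IH1 IH2.
Qed.

(** Induction on the execution, not on the command: the body of a loop exits to the loop test at
    [a], where the hypothesis for the remaining rounds applies. [P] has to agree with the code on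
    its block only, so blocks nest in one table. *)
Lemma flatP (P : nat -> instr) i0 c a e s s' :
  (forall i, i < csize c -> P (a + i) = nth i0 (flat c a e) i) ->
  exec c s s' -> exists k, iter k (mstep P) (a, s) = (e, s').
Proof.
move=> + ex; elim: ex a e => {c s s'}.
- move=> s a e /(_ 0 isT); rewrite addn0 /= => Pa; exists 1.
  rewrite /= /mstep Pa /=; congr pair; store_eq.
- move=> r s a e /(_ 0 isT); rewrite addn0 /= => Pa; exists 1.
  by rewrite /= /mstep Pa.
- move=> c1 c2 s1 s2 s3 _ IH1 _ IH2 a e Pa.
  have [|k1 k1E] := IH1 a (a + csize c1).
    by move=> i ic; rewrite Pa /= ?nth_cat ?size_flat ?ic //; lia.
  have [|k2 k2E] := IH2 (a + csize c1) e.
    move=> i ic; rewrite -addnA Pa /= ?nth_cat ?size_flat; last lia.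
    by rewrite addKn; case: ifP => //; lia.
  by exists (k2 + k1); rewrite iterD k1E.
- move=> r c s r0 sr a e /(_ 0 isT); rewrite addn0 /= => Pa; exists 1.
  by rewrite /= /mstep Pa /= sr (negbTE r0).
- move=> r c s1 s2 s3 r0 sr _ IH1 _ IH2 a e Pa.
  have [|k1 k1E] := IH1 a.+1 a.
    by move=> i ic; rewrite addSnnS Pa.
  have [k2 k2E] := IH2 a e Pa.
  exists (k2 + (k1 + 1)); rewrite iterD iterD /= {3}/mstep /=.
  by have := Pa 0 isT; rewrite addn0 /= => ->; rewrite sr orbT k1E.
Qed.

(** * Register machines as tile systems *)

(** Kinds 0 and 1 mark the preamble, whose length [z] is the input of the machine. This is the only
    way in which [z] enters a tiling. *)
Definition phase_ok (z kind row : nat) : bool :=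
  match kind with
  | 0 => row < 1
  | 1 => 1 <= row < z
  | _ => z <= row
  end.

(** Rows of length [p] are written one after the other: [succ] relates neighbours, also across row
    ends, and [copy] a cell to the one below. The last row may be incomplete. *)
Definition tiling (T : Type) (succ copy : rel T) (kind : T -> nat)
    (start final : pred T) (z p n : nat) (l : nat -> T) : Prop :=
  [/\ (0 < p) && start (l 0),
      forall i, i < n -> succ (l i) (l i.+1),
      forall i, i + p <= n -> copy (l i) (l (i + p)),
      forall i, i <= n -> phase_ok z (kind (l i)) (i %/ p)
    & final (l n)].

Definition tileable (T : Type) succ copy kind start final z : Prop :=
  exists p n l, @tiling T succ copy kind start final z p n l.

(** A row lists tokens, each named by the register that holds it, so register contents are
    multiplicities. A transfer renames the leftmost suitable token and keeps the length of the
    row. *)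
Fixpoint replace (r1 r2 : nat) (s : seq nat) : seq nat :=
  if s is r :: s' then
    if r == r1 then r2 :: s' else r :: replace r1 r2 s'
  else [::].

Lemma size_replace r1 r2 s : size (replace r1 r2 s) = size s.
Proof. by elim: s => //= r s IHs; case: eqP => //= _; rewrite IHs. Qed.

Lemma nth_replace r1 r2 s j : j < size s -> nth 0 (replace r1 r2 s) j =
  if (r1 \notin take j s) && (nth 0 s j == r1) then r2 else nth 0 s j.
Proof.
elim: s j => [|r s IHs] [|j] //= lt_js.
  by case: eqP.
by rewrite inE negb_or; case: (eqVneq r r1) => [_|rr1] //=; rewrite IHs.
Qed.

Lemma replaceE r1 r2 s : r1 \notin s -> replace r1 r2 s = s.
Proof.
elim: s => //= r s IHs; rewrite inE negb_or => /andP[r1r /IHs->].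
by rewrite eq_sym (negbTE r1r).
Qed.

Lemma count_replace r1 r2 s r : r1 \in s ->
  count_mem r (replace r1 r2 s) = count_mem r s - (r == r1) + (r == r2).
Proof.
elim: s => //= a s IHs; rewrite inE; case: (eqVneq a r1) => [->|_] /= r1s.
  by rewrite ![r == _]eq_sym; case: (eqVneq r1 r); case: (eqVneq r2 r); lia.
have : 0 < count_mem r1 s by rewrite -has_count has_pred1.
rewrite IHs //; case: (eqVneq r r1) => [->|_] /=; last by rewrite !subn0 addnA.
by move=> cs; rewrite addnA addnBA.
Qed.

Lemma all_replace (B r1 r2 : nat) s : r2 <= B -> all (leq^~ B) s ->
  all (leq^~ B) (replace r1 r2 s).
Proof.
move=> r2B; elim: s => //= r s IHs /andP[rB sB].
by case: eqP => _ /=; rewrite ?r2B ?rB ?sB ?IHs.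
Qed.

Section Machine.

Variables (P : nat -> instr) (h B z : nat).
Hypothesis z_gt0 : 0 < z.

(* Row states 0 and 1 belong to the preamble, which puts one token into
   register 1 during each of the first [z] rows; row state [q.+2] is the
   state [q] of the machine. *)
Definition rd q : nat := if q is q'.+2 then (P q').1.1.1 else 0.
Definition wr q : nat := if q is q'.+2 then (P q').1.1.2 else 1.

(** The choice between 1 and 2 is left to the phase condition. No next state exists when a token is
    sought in register 0 and absent, so a row that is too short cannot continue. *)
Definition next_state q (b : bool) q' : bool :=
  if q is q1.+2 then
    if b then q' == (P q1).1.2.+2 else (rd q != 0) && (q' == (P q1).2.+2)
  else b && ((q' == 1) || (q' == 2)).

(* A letter holds the state of its row, a flag telling whether the cell sought
   by this state occurs strictly to the left in the row, and the content of a
   cell, where [None] marks the beginning of the row. *)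
Definition letter : finType := ('I_B.+1 * bool * option 'I_B.+1)%type.

Definition lstate (l : letter) : nat := l.1.1.
Definition lflag (l : letter) : bool := l.1.2.
Definition lcell (l : letter) : option nat := omap val l.2.

Definition mk_letter q b (c : option nat) : letter := (inord q, b, omap inord c).

Definition lfound (l : letter) : bool :=
  lflag l || (lcell l == Some (rd (lstate l))).

(** Within a row the state is carried along while the flag records the search; at the next row
    marker the completed search decides the state. The condition on state 0 fills the first row with
    supply tokens. *)
Definition lsucc (l l' : letter) : bool :=
  if lcell l' is Some c then
    [&& lstate l' == lstate l, lflag l' == lfound l
      & (lstate l' == 0) ==> (c == 0)]
  else ~~ lflag l' && next_state (lstate l) (lfound l) (lstate l').

Definition lcopy (l l' : letter) : bool :=
  lcell l' == if ~~ lflag l && (lcell l == Some (rd (lstate l)))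
              then Some (wr (lstate l)) else lcell l.

Definition lkind (l : letter) : nat := lstate l.
Definition lstart (l : letter) : bool :=
  [&& lstate l == 0, ~~ lflag l & lcell l == None].
Definition lfinal (l : letter) : bool := lstate l == h.+2.

(** State and tokens of row [k] as the constraints force them; one of the [p] cells is the row
    marker, which leaves [p.-1] tokens. *)
Fixpoint rconf (p k : nat) : nat * seq nat :=
  if k is k'.+1 then
    let: (q, row) := rconf p k' in
    (if q is q1.+2 then
       if rd q \in row then (P q1).1.2.+2 else (P q1).2.+2
     else if k < z then 1 else 2,
     replace (rd q) (wr q) row)
  else (0, nseq p.-1 0).

Definition unstuck p k : bool :=
  (rd (rconf p k).1 != 0) || (0 \in (rconf p k).2).

(** What row [k] should represent: [k] tokens put into register 1 during the preamble, and [k - z]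
    machine steps from row [z] on. *)
Definition mconf k : nat * store :=
  if k < z then (nat_of_bool (0 < k), upd (fun=> 0) 1 k)
  else let c := iter (k - z) (mstep P) (0, upd (fun=> 0) 1 z) in (c.1.+2, c.2).

(** Each row performs one transfer, so multiplicities follow register contents as long as the finite
    supply of the row imitates the inexhaustible register 0. *)
Lemma rconfP p k : (forall k', k' < k -> unstuck p k') ->
  (rconf p k).1 = (mconf k).1 /\
  forall r, r != 0 -> count_mem r (rconf p k).2 = (mconf k).2 r.
Proof.
elim: k => [|k IHk] uk.
  rewrite /mconf z_gt0; split=> //= r r0.
  by rewrite count_nseq /= eq_sym (negbTE r0) /upd; case: eqP.
have := uk k (ltnSn k); rewrite /unstuck.
have [] := IHk; first by move=> k' k'k; apply: uk; lia.
rewrite [rconf p k.+1]/=; case: (rconf p k) => q row /= {IHk uk}.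
rewrite /mconf; case: (ltnP k z) => kz /= -> cnt.
  have -> : rd (0 < k) = 0 by case: (0 < k).
  have -> : wr (0 < k) = 1 by case: (0 < k).
  move=> /= row0.
  have {}cnt r : r != 0 -> count_mem r (replace 0 1 row) = upd (fun=> 0) 1 k.+1 r.
    move=> r0; rewrite count_replace // cnt // /upd (negbTE r0).
    by case: (r == 1); lia.
  case: (ltnP k.+1 z) => k1z; last have -> : k.+1 = z by lia.
    by split=> //; case: (0 < k).
  rewrite subnn; split; first by case: (0 < k).
  by move=> r r0 /=; rewrite cnt //; have -> : k.+1 = z by lia.
have -> : k.+1 < z = false by lia.
rewrite subSn //= /mstep; move: (iter _ _ _) cnt => -[q1 s] /= cnt.
case: (P q1) => -[[r1 r2] j1] j0 /=.
case: (posnP r1) => [->|r1_gt0] /=.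
  move=> row0; rewrite row0; split=> // r r0.
  by rewrite count_replace // cnt // /transfer (negbTE r0) subn0.
rewrite -cnt -?lt0n // -has_count has_pred1.
case: ifP => r1row _; split=> // r r0 /=.
  by rewrite count_replace // cnt // /transfer (negbTE r0).
by rewrite replaceE ?r1row // cnt.
Qed.

Lemma size_rconf p k : size (rconf p k).2 = p.-1.
Proof.
elim: k => [|k] /=; first by rewrite size_nseq.
by case: (rconf p k) => q row /=; rewrite size_replace.
Qed.

(** The constraints determine the rows from top to bottom, so a tiling spells out the run, whatever
    its row length. *)
Lemma tileable_halting : tileable lsucc lcopy lkind lstart lfinal z ->
  exists k, (iter k (mstep P) (0, upd (fun=> 0) 1 z)).1 = h.
Proof.
move=> [p [n [l [/andP[p_gt0 l0] lS lC lK lF]]]].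
pose cell row j := if j is j'.+1 then Some (nth 0 row j') else None.
(* Along one row, the first letter and the cells determine all states and flags. *)
have rowP k q row : lstate (l (k * p)) = q -> ~~ lflag (l (k * p)) ->
    size row = p.-1 ->
    (forall j, j < p -> k * p + j <= n -> lcell (l (k * p + j)) = cell row j) ->
    forall j, j < p -> k * p + j <= n ->
    [/\ lstate (l (k * p + j)) = q,
        lflag (l (k * p + j)) = (0 < j) && (rd q \in take j.-1 row)
      & lfound (l (k * p + j)) = (rd q \in take j row)].
  move=> lq lb srow lc; elim=> [|j IHj] jp jn.
    by rewrite /lfound lc // addn0 lq (negbTE lb) take0.
  have [||jq jb jf] := IHj; try lia.
  have := lS (k * p + j); rewrite -addnS => /(_ _).
  rewrite /lsucc lc //= => /(_ ltac:(lia)) /and3P[/eqP sE /eqP bE _].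
  rewrite /lfound bE sE jq jf lc //; split=> //=.
  rewrite (take_nth 0) ?srow; last lia.
  rewrite mem_rcons inE orbC eq_sym.
  by congr (_ || _); apply/eqP/eqP => [->|[->]].
have main k : k * p <= n ->
    [/\ lstate (l (k * p)) = (rconf p k).1, ~~ lflag (l (k * p)),
        forall j, j < p -> k * p + j <= n ->
          lcell (l (k * p + j)) = cell (rconf p k).2 j
      & forall k', k' < k -> unstuck p k'].
  elim: k => [|k IHk] kn.
    case/and3P: l0 => /eqP l0q l0b /eqP l0c; split=> //.
    elim=> [|j IHj] jp jn //=; rewrite nth_nseq if_same.
    (* In row 0 the phase condition leaves only state 0, as [z] is positive. *)
    have q0 i : i < p -> i <= n -> lstate (l i) = 0.
      move=> ip ni; have := lK i ni; rewrite divn_small // /lkind.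
      by case: (lstate (l i)) => [|[|q]] //=; lia.
    have := lS j; rewrite /lsucc !q0; try lia.
    case: (lcell _) => [c /(_ jn)/and3P[_ _ /eqP->]//|/(_ jn)].
    by rewrite /= !andbF.
  have [|kq kb kc ku] := IHk; first lia.
  have kr := rowP _ _ _ kq kb (size_rconf p k) kc.
  have c' j : j < p -> k.+1 * p + j <= n ->
      lcell (l (k.+1 * p + j)) = cell (rconf p k.+1).2 j.
    move=> jp jn; have := lC (k * p + j).
    have -> : k * p + j + p = k.+1 * p + j by lia.
    move=> /(_ jn); have [|jq jb _] := kr j jp; first lia.
    rewrite /lcopy jq jb kc //; last lia.
    move=> /eqP->; have := size_rconf p k.
    rewrite [rconf p k.+1]/=; case: (rconf p k) => q row /= srow.
    case: j jp {jn jq jb} => //= j jp; rewrite nth_replace; last lia.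
    have -> : (Some (nth 0 row j) == Some (rd q)) = (nth 0 row j == rd q).
      by apply/eqP/eqP => [[->]|->].
    by case: ifP.
  have [||pq _ pf] := kr p.-1; try lia.
  have Ep : (k * p + p.-1).+1 = k.+1 * p by lia.
  have := lS (k * p + p.-1); rewrite Ep => /(_ kn).
  rewrite /lsucc -[X in lcell (l X)](addn0 (k.+1 * p)) c' ?addn0 //= pf pq.
  have -> : take p.-1 (rconf p k).2 = (rconf p k).2.
    by rewrite -(size_rconf p k) take_size.
  move=> /andP[-> nq].
  have kK : phase_ok z (lstate (l (k.+1 * p))) k.+1.
    by have := lK _ kn; rewrite mulnK.
  have [qE uk] : lstate (l (k.+1 * p)) = (rconf p k.+1).1 /\ unstuck p k.
    move: nq kK; rewrite [rconf p k.+1]/= /unstuck.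
    case: (rconf p k) => -[|[|q]] row /=.
    - by case/andP => -> /orP[] /eqP-> /= kz; split=> //; case: ifP; lia.
    - by case/andP => -> /orP[] /eqP-> /= kz; split=> //; case: ifP; lia.
    case: ifP => rq; last by case/andP => -> /eqP->.
    move/eqP->; split=> //; case: eqP => //= r0; by rewrite r0 in rq.
  by split=> // k'; rewrite ltnS leq_eqVlt => /predU1P[->//|]; apply: ku.
(* The last letter may stand anywhere in row [n %/ p], but the state is constant along the row. *)
have En := divn_eq n p.
have [|kq kb kc ku] := main (n %/ p); first lia.
have [|nq _ _] := rowP _ _ _ kq kb (size_rconf p _) kc (n %% p) (ltn_pmod n p_gt0).
  by rewrite -En.
move: lF; rewrite /lfinal -{1}En in nq *; rewrite nq (rconfP ku).1 /mconf.
case: ltnP => [_|zn]; first by case: (0 < _).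
by move=> /eqP[<-]; eexists.
Qed.

Hypothesis PB : forall q, let: (r1, r2, j1, j0) := P q in
  [/\ r1 <= B, r2 <= B, j1.+2 <= B & j0.+2 <= B].
Hypothesis B_gt1 : 1 < B.

(** A row draws at most one token from the supply. *)
Lemma count0_rconf p k : p.-1 - k <= count_mem 0 (rconf p k).2.
Proof.
elim: k => [|k] /=; first by rewrite count_nseq /= mul1n; lia.
case: (rconf p k) => q row /= IHk.
case: (boolP (rd q \in row)) => [rq|/replaceE->]; last lia.
rewrite count_replace //; move: (count _ _) IHk => c; lia.
Qed.

Lemma rconf_bound p k :
  (rconf p k).1 <= B /\ all (leq^~ B) (rconf p k).2.
Proof.
elim: k => [|k] /=; first by split=> //; apply/allP => r /nseqP[->].
case: (rconf p k) => q row /= [qB rowB].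
case: q qB => [|[|q]] qB /=.
- by split; [case: ifP; lia|apply: all_replace => //; lia].
- by split; [case: ifP; lia|apply: all_replace => //; lia].
have := PB q; case: (P q) => -[[r1 r2] j1] j0 /= [r1B r2B j1B j0B].
by split; [case: ifP|apply: all_replace].
Qed.

Lemma lstate_mk q b c : q <= B -> lstate (mk_letter q b c) = q.
Proof. exact: inordK. Qed.

Lemma lcell_mk q b c : oapp (leq^~ B) true c -> lcell (mk_letter q b c) = c.
Proof. by case: c => //= c cB; rewrite /lcell /= inordK. Qed.

Definition row_letter q (row : seq nat) j : letter :=
  mk_letter q ((0 < j) && (rd q \in take j.-1 row))
    (if j is j'.+1 then Some (nth 0 row j') else None).

Lemma row_found q row j : q <= B -> all (leq^~ B) row -> j <= size row ->
  lfound (row_letter q row j) = (rd q \in take j row).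
Proof.
move=> qB rowB jrow; rewrite /lfound lstate_mk // lcell_mk.
  case: j jrow => [|j] jrow /=; first by rewrite take0.
  rewrite (take_nth 0) // mem_rcons inE orbC eq_sym.
  by congr (_ || _); apply/eqP/eqP => [->|[->]].
by case: j jrow => //= j jrow; apply: (allP rowB); apply: mem_nth.
Qed.

Lemma halting_tileable k :
  (iter k (mstep P) (0, upd (fun=> 0) 1 z)).1 = h ->
  tileable lsucc lcopy lkind lstart lfinal z.
Proof.
(* The [p.-1 = K] tokens last for [K] rows. The word ends with the marker of row [K], which already
   carries the final state. *)
move=> hk; pose K := z + k; pose p := K.+1; exists p, (K * p).
have uK i : i < K -> unstuck p i.
  move=> iK; apply/orP; right; have := count0_rconf p i.
  rewrite -has_pred1 has_count; apply: leq_trans; rewrite /p; lia.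
have cK i : i <= K -> (rconf p i).1 = (mconf i).1.
  by move=> iK; apply: (rconfP _).1 => j ji; apply: uK; lia.
pose l i := row_letter (rconf p (i %/ p)).1 (rconf p (i %/ p)).2 (i %% p).
have sB i : (rconf p i).1 <= B by have [] := rconf_bound p i.
have rB i : all (leq^~ B) (rconf p i).2 by have [] := rconf_bound p i.
have lS i : lstate (l i) = (rconf p (i %/ p)).1 by rewrite lstate_mk.
have jB i : i %% p <= size (rconf p (i %/ p)).2.
  by rewrite size_rconf -ltnS ltn_pmod.
have lF i : lfound (l i) = (rd (lstate (l i)) \in take (i %% p) (rconf p (i %/ p)).2).
  by rewrite lS row_found.
have lC i : lcell (l i) =
    if i %% p is j.+1 then Some (nth 0 (rconf p (i %/ p)).2 j) else None.
  rewrite lcell_mk //; have := jB i; case: (i %% p) => //= j jr.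
  by apply: (allP (rB _)); apply: mem_nth.
exists l; split.
- rewrite /= /lstart lS lC mod0n div0n eqxx andbT /lflag /l /=.
  by rewrite ?mod0n.
- move=> i iK; rewrite /lsucc lC lF !lS.
  have p_gt0 : 0 < p by [].
  have Ei := divn_eq i p; have lti := ltn_pmod i p_gt0.
  move: (i %/ p) (i %% p) Ei lti (lF i) => d j Ei ltj _.
  case: (ltnP j.+1 p) => jp.
    have Ed : i.+1 %/ p = d by rewrite Ei -addnS divnMDl // divn_small // addn0.
    have Ej : i.+1 %% p = j.+1 by rewrite Ei -addnS modnMDl modn_small.
    rewrite Ed Ej eqxx /=; apply/andP; split.
      by rewrite /l /lflag /= Ed Ej.
    apply/implyP => /eqP d0.
    case: d d0 {Ei Ed} => [|d] /=; first by rewrite nth_nseq; case: ifP.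
    by case: (rconf p d) => -[|[|q]] row //=; case: ifP.
  have {jp}jE : j = K by rewrite /p in ltj jp; lia.
  have Ed : i.+1 %/ p = d.+1.
    by rewrite Ei -addnS jE -[K.+1]/p -mulSnr mulnK.
  have Ej : i.+1 %% p = 0 by rewrite Ei -addnS jE -[K.+1]/p -mulSnr modnMl.
  have dK : d < K by rewrite -(ltn_pmul2r p_gt0) (leq_ltn_trans _ iK) // Ei leq_addr.
  rewrite Ed Ej /lflag /l /= Ej /= jE.
  have -> : K = size (rconf p d).2 by rewrite size_rconf.
  rewrite take_size; have := uK d dK; rewrite /unstuck.
  case: (rconf p d) => -[|[|q]] row /= ud.
  + by rewrite ud; case: ifP.
  + by rewrite ud; case: ifP.
  case: ifP => rq; rewrite rq eqxx // andbT.
  by apply: contraFneq rq => r0; move: ud; rewrite r0.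
- move=> i _; rewrite /lcopy !lC.
  have -> : (i + p) %/ p = (i %/ p).+1 by rewrite divnDr ?dvdnn // divnn addn1.
  rewrite modnDr !lS /lflag {1}/l /=.
  have := jB i; have := rB (i %/ p) => _.
  case: (rconf p (i %/ p)) => q row /=; case: (i %% p) => //= j jr.
  rewrite nth_replace //.
  have -> : (Some (nth 0 row j) == Some (rd q)) = (nth 0 row j == rd q).
    by apply/eqP/eqP => [[->]|->].
  by case: ifP.
- move=> i iK; have dK : i %/ p <= K by rewrite -(mulnK K (ltn0Sn K)) leq_div2r.
  rewrite /lkind lS cK // /mconf; case: ltnP => dz /=; last by case: z dz z_gt0.
  by case: (posnP (i %/ p)) => [->|d_gt0] //=; lia.
- rewrite /lfinal lS mulnK // cK // /mconf.
  by rewrite ltnNge leq_addr /= addKn hk.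
Qed.

End Machine.

(** * The timed automaton of a tile system *)

Section Automaton.

Local Open Scope ring_scope.

Variables (k : nat) (x y : 'I_k) (m : nat).
Variables (succ copy : nat -> nat -> bool) (kind : nat -> nat).
Variables (start final : nat -> bool) (z : nat).

(* [Succ a] is entered on reading a letter [a], and observes the next event;
   [Copy a] waits for the events one time unit later; [Two] is reached after two
   consecutive events, which reset [x] and [y] respectively. *)
Inductive loc :=
  Init | Priv | Fin | Acc | Wait | Two | Succ of 'I_m.+1 | Copy of 'I_m.+1.

Definition loc_nat (q : loc) : nat :=
  match q with
  | Init => 0 | Priv => 1 | Fin => 2 | Acc => 3 | Wait => 4 | Two => 5
  | Succ a => 6 + a
  | Copy a => 6 + m.+1 + a
  end%N.

Definition nloc : nat := (m.+1 + m.+1).+4.+2%N.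

Definition at_ (q : loc) : 'I_nloc := inord (loc_nat q).

Lemma loc_nat_lt q : (loc_nat q < nloc)%N.
Proof. by case: q => //= a; have := ltn_ord a; rewrite /nloc; lia. Qed.

Lemma at_K q : at_ q = loc_nat q :> nat.
Proof. by rewrite inordK // loc_nat_lt. Qed.

Lemma at_inj : injective at_.
Proof.
move=> q q' /(congr1 (@nat_of_ord _)); rewrite !at_K.
by case: q => [||||||a|a]; case: q' => [||||||b|b] //= E;
  try lia; try (have := ltn_ord a); try (have := ltn_ord b);
  try lia; move=> _ _; congr (_ _); apply: val_inj => /=; lia.
Qed.

Definition tr q g (a : option 'I_m.+1) r q' : edge 'I_m.+1 'I_nloc 'I_k :=
  (at_ q, g, a, r, at_ q').

(** With [high_guard], the ways to break the phase condition in [Wait], where [y] still shows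
    absolute time. An impossible violation gets the unsatisfiable guard [y < 0], so that the list of
    edges keeps its shape. *)
Definition low_guard c : guard 'I_k :=
  [:: (y, CmpLt, Posz (if c == 0 then 0 else if c == 1 then 1 else z)%N)].

Definition high_guard c : guard 'I_k :=
  if c == 0%N then [:: (y, CmpGe, Posz 1)]
  else if c == 1%N then [:: (y, CmpGe, Posz z)]
  else [:: (y, CmpLt, Posz 0)].

(** Each edge entering [Acc] from elsewhere certifies a violation, and [Acc] reads the rest; [Wait]
    moves to [Fin] if the word ends in a nonfinal letter. [Copy a] loops while [x < 1], so its exit
    takes the first event at distance at least one. The tables affect only guards and targets, never
    the number of edges. *)
Definition letter_edges (a b : 'I_m.+1) : seq (edge 'I_m.+1 'I_nloc 'I_k) :=
  [:: tr Priv [::] (Some a) finset.set0 Priv;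
      tr Acc [::] (Some a) finset.set0 Acc;
      tr Wait [::] (Some a) finset.set0 Wait;
      tr Wait [::] (Some a) finset.set0 (if final a then Wait else Fin);
      tr Wait (low_guard (kind a)) (Some a) finset.set0 Acc;
      tr Wait (high_guard (kind a)) (Some a) finset.set0 Acc;
      tr Init (if start a then [:: (y, CmpGt, Posz 0)] else [::])
        (Some a) finset.set0 Acc;
      tr Wait [::] (Some a) [set x] (Succ a);
      tr Wait [::] (Some a) [set x] (Copy a);
      tr Two [::] (Some a) finset.set0 Two;
      tr Two [:: (x, CmpGt, Posz 1); (y, CmpLt, Posz 1)] (Some a) finset.set0 Acc;
      tr (Succ a) (if succ a b then [:: (x, CmpEq, Posz 0)] else [::])
        (Some b) finset.set0 Acc;
      tr (Succ a) [::] (Some b) [set y] Two;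
      tr (Copy a) [:: (x, CmpLt, Posz 1)] (Some b) finset.set0 (Copy a);
      tr (Copy a) [:: (x, if copy a b then CmpGt else CmpGe, Posz 1)]
        (Some b) finset.set0 Acc].

Definition silent_edges : seq (edge 'I_m.+1 'I_nloc 'I_k) :=
  [:: tr Init [::] None finset.set0 Priv; tr Init [::] None finset.set0 Wait;
      tr Init [::] None finset.set0 Fin; tr Priv [::] None finset.set0 Fin;
      tr Acc [::] None finset.set0 Fin].

(** A pair of letters is decoded from one index, so that a single iteration can produce the list. *)
Definition all_edges : seq (edge 'I_m.+1 'I_nloc 'I_k) :=
  silent_edges ++
  flatten [seq letter_edges (inord (i %/ m.+1)) (inord (i %% m.+1))
          | i <- iota 0 (m.+1 * m.+1)].

Definition checker : timed_automaton 'I_m.+1 'I_nloc 'I_k :=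
  TimedAutomaton (at_ Init) [set at_ Priv] [set at_ Fin] [ffun=> [::]] all_edges.

Lemma silent_mem e : e \in silent_edges -> e \in all_edges.
Proof. by rewrite mem_cat => ->. Qed.

Lemma letter_mem a b e : e \in letter_edges a b -> e \in all_edges.
Proof.
move=> eab; rewrite mem_cat; apply/orP; right; apply/flattenP.
exists (letter_edges a b) => //; apply/mapP; exists (a * m.+1 + b)%N.
  rewrite mem_iota /= add0n mulSn addnC -ltn_subRL.
  have := ltn_ord a; have := ltn_ord b => hb ha.
  by rewrite ltn_subRL; nia.
by rewrite divnMDl // divn_small // addn0 modnMDl modn_small // !inord_val.
Qed.

Lemma all_edgesP e : e \in all_edges ->
  e \in silent_edges \/ exists a b, e \in letter_edges a b.
Proof.
rewrite mem_cat => /orP[?|/flattenP[_ /mapP[i _ ->] ei]]; first by left.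
by right; eexists; eexists; exact: ei.
Qed.

(** * Acceptance, and opacity as universality of public traces *)

Variable R : realType.
Implicit Types (D : pred 'I_nloc) (t : R).
Hypothesis xy : x != y.

Notation cval := (@valuation R 'I_k).
Notation word := (seq ('I_m.+1 * R)).

Definition nonneg (mu : cval) := forall c, 0 <= mu c.

(** Runs may start anywhere and at any time, which permits induction on the word; [D] will exclude
    [Priv] to express public runs. *)
Definition accepts (D : pred 'I_nloc) q (mu : cval) t (w : word) : Prop :=
  exists s, [/\ run_from checker (at_ q, mu) s,
    all (fun st : run_step => D st.2.1) s & trace_from t s = w].

Lemma sat_inv (mu : cval) l : sat mu (ta_inv checker l).
Proof. by rewrite ffunE. Qed.

Lemma accepts_fin D mu t : accepts D Fin mu t [::].
Proof. by exists [::]; rewrite /= inE eqxx. Qed.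

Lemma nonneg_delay (mu : cval) d : nonneg mu -> 0 <= d -> nonneg (val_delay mu d).
Proof. by move=> mu0 d0 c; rewrite ffunE addr_ge0. Qed.

Lemma nonneg_reset (mu : cval) r : nonneg mu -> nonneg (val_reset mu r).
Proof. by move=> mu0 c; rewrite ffunE; case: ifP. Qed.

Lemma accepts_step D q g a r q' mu t (t' : R) w :
  tr q g (Some a) r q' \in all_edges -> q <> Fin -> D (at_ q') -> nonneg mu ->
  t <= t' -> sat (val_delay mu (t' - t)) g ->
  accepts D q' (val_reset (val_delay mu (t' - t)) r) t' w ->
  accepts D q mu t ((a, t') :: w).
Proof.
move=> eE qF Dq' mu0 tt' gE [s [rs Ds sw]].
have d0 : 0 <= t' - t by rewrite subr_ge0.
exists ((t' - t, tr q g (Some a) r q',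
  (at_ q', val_reset (val_delay mu (t' - t)) r)) :: s); split.
- split=> //; first by rewrite inE; apply/eqP => /at_inj.
  exists (at_ q, val_delay mu (t' - t)); first by split=> // *; exact: sat_inv.
  split=> //; split; last exact: sat_inv.
  by apply: nonneg_reset; exact: nonneg_delay.
- by rewrite /= Dq'.
- by rewrite /= addrC subrK sw.
Qed.

Lemma accepts_silent D q q' mu t w :
  tr q [::] None finset.set0 q' \in all_edges -> q <> Fin -> D (at_ q') -> nonneg mu ->
  accepts D q' mu t w -> accepts D q mu t w.
Proof.
move=> eE qF Dq' mu0 [s [rs Ds sw]].
have mu_eq : val_reset (val_delay mu 0) finset.set0 = mu.
  by apply/ffunP => c; rewrite !ffunE inE addr0.
exists ((0, tr q [::] None finset.set0 q', (at_ q', mu)) :: s); split.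
- split=> //; first by rewrite inE; apply/eqP => /at_inj.
  exists (at_ q, val_delay mu 0); first by split=> // *; exact: sat_inv.
  by split; rewrite //= ?mu_eq //; split=> //; exact: sat_inv.
- by rewrite /= Dq'.
- by rewrite /= addr0 sw.
Qed.

Definition monotone (t : R) (w : word) : bool := path <=%R t (map snd w).

Lemma accepts_sink D q mu t w :
  (forall a, tr q [::] (Some a) finset.set0 q \in all_edges) ->
  tr q [::] None finset.set0 Fin \in all_edges -> q <> Fin ->
  D (at_ q) -> D (at_ Fin) -> nonneg mu -> monotone t w -> accepts D q mu t w.
Proof.
move=> loop exit qF Dq DF; elim: w mu t => [|[a t'] w IHw] mu t mu0.
  by move=> _; apply: accepts_silent exit _ _ _ (accepts_fin _ _ _).
rewrite /monotone /= => /andP[tt' ww].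
apply: accepts_step (loop a) _ _ _ _ _ _ => //; apply: IHw => //.
by apply: nonneg_reset; apply: nonneg_delay => //; rewrite subr_ge0.
Qed.

Lemma nonneg0 : nonneg val0.
Proof. by move=> c; rewrite ffunE. Qed.

Lemma trace_monotone t s c : run_from checker c s ->
  monotone t (trace_from t s).
Proof.
suff gen t' : t' <= t -> run_from checker c s -> monotone t' (trace_from t s).
  exact: gen.
elim: s t t' c => [|[[d e] c'] s IHs] t t' c tt' //= [_ [c1 [d0 _ _] _] rs].
case: (edge_act e) => [a|]; last by apply: IHs rs; lra.
by rewrite /monotone /=; apply/andP; split; [lra|apply: IHs rs].
Qed.

Lemma priv_traces : @PrivTr R _ _ _ checker = [set w | monotone 0 w]%classic.
Proof.
apply/seteqP; split=> w /=.
  by move=> [s [[_ rs] _ <-]]; exact: trace_monotone rs.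
move=> w0; have [s [rs _ sw]] : accepts predT Priv val0 0 w.
  apply: accepts_sink => //; last exact: nonneg0.
    by move=> a; apply: (@letter_mem a a); rewrite !inE eqxx.
  by apply: silent_mem; rewrite !inE eqxx !orbT.
have mu_eq : val_reset (val_delay (val0 : cval) 0) finset.set0 = val0.
  by apply/ffunP => c; rewrite !ffunE inE addr0.
exists ((0, tr Init [::] None finset.set0 Priv, (at_ Priv, val0)) :: s); split.
- split; first by split; [exact: nonneg0|exact: sat_inv].
  split=> //; first by rewrite inE; apply/eqP => /at_inj.
  exists (at_ Init, val_delay val0 0); first by split=> // *; exact: sat_inv.
  split=> //=; rewrite ?mu_eq //; first by apply: silent_mem; rewrite inE eqxx.
  by split; [exact: nonneg0|exact: sat_inv].
- by rewrite /private_run /visited /= !inE eqxx orbT.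
- by rewrite /trace /= addr0.
Qed.

Notation public := (fun q : 'I_nloc => q != at_ Priv).

Lemma pub_traceP w : PubTr checker w <-> accepts public Init val0 0 w.
Proof.
split=> [[s [[_ rs] ns sw]]|[s [rs ps sw]]].
  exists s; split=> //; apply/allP => st sts; apply: contraNN ns => /eqP stP.
  rewrite /private_run /visited /= inE; apply/orP; right.
  by apply/hasP; exists (at_ Priv); [apply/mapP; exists st|rewrite inE].
exists s; split=> //; first by split=> //; split; [exact: nonneg0|exact: sat_inv].
rewrite /private_run /visited /= inE negb_or; apply/andP; split.
  by apply/eqP => /at_inj.
rewrite has_map -all_predC; apply: sub_all ps => st /=.
by rewrite inE.
Qed.

(** Private traces are all the monotone words and every trace is monotone, so inclusion and equality
    both mean that public runs read every monotone word. *)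
Lemma opaque_traces :
  (weakly_opaque R checker <-> forall w, monotone 0 w -> PubTr checker w) /\
  (fully_opaque R checker <-> forall w, monotone 0 w -> PubTr checker w).
Proof.
split; split.
- by rewrite /weakly_opaque priv_traces => h w /h.
- by rewrite /weakly_opaque priv_traces => h w /h.
- by rewrite /fully_opaque priv_traces => <- w.
- rewrite /fully_opaque priv_traces => h; apply/seteqP; split=> w /=.
    exact: h.
  by move=> [s [[_ rs] _ <-]]; exact: trace_monotone rs.
Qed.


Definition letter_edge a b i := nth (tr Init [::] None finset.set0 Init) (letter_edges a b) i.

Lemma letter_edge_mem a b i : (i < 15)%N -> letter_edge a b i \in all_edges.
Proof. by move=> i15; apply: (@letter_mem a b); apply: mem_nth. Qed.

(** * Words without violations are tilings *)

Section Violations.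

Variable w : word.
Hypothesis w_mono : monotone 0 w.

Let n := size w.
Let lt i := (nth (ord0, 0) w i).1.
Let tm i := (nth (ord0, 0) w i).2.
Let prev i := if i is j.+1 then tm j else 0.

Lemma prev_le i : (i < n)%N -> prev i <= tm i.
Proof.
move=> lt_in; have /(pathP 0)/(_ i) := w_mono; rewrite size_map => /(_ lt_in).
rewrite (nth_map (ord0, 0)) //; case: i lt_in => [|i] //= lt_in.
by rewrite (nth_map (ord0, 0)) // ltnW.
Qed.

Lemma monotone_drop i : (i <= n)%N -> monotone (prev i) (drop i w).
Proof.
elim: i => [|i IHi] lt_in; first by rewrite drop0.
have := IHi (ltnW lt_in); rewrite (drop_nth (ord0, 0)) //.
by rewrite /monotone /= => /andP[].
Qed.

Lemma accepts_event q g r q' mu i : (i < n)%N ->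
  tr q g (Some (lt i)) r q' \in all_edges -> q <> Fin -> q' <> Priv ->
  nonneg mu -> sat (val_delay mu (tm i - prev i)) g ->
  (nonneg (val_reset (val_delay mu (tm i - prev i)) r) ->
   accepts public q' (val_reset (val_delay mu (tm i - prev i)) r) (tm i)
     (drop i.+1 w)) ->
  accepts public q mu (prev i) (drop i w).
Proof.
move=> lt_in eE qF q'P mu0 gE acc; rewrite (drop_nth (ord0, 0)) //.
rewrite [nth _ _ _]surjective_pairing.
apply: accepts_step eE _ _ _ _ gE _ => //.
- by apply/eqP => /at_inj.
- exact: prev_le.
apply: acc; apply: nonneg_reset; apply: nonneg_delay => //.
by rewrite subr_ge0 prev_le.
Qed.

Lemma accepts_violation q g r mu i : (i < n)%N ->
  tr q g (Some (lt i)) r Acc \in all_edges -> q <> Fin ->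
  nonneg mu -> sat (val_delay mu (tm i - prev i)) g ->
  accepts public q mu (prev i) (drop i w).
Proof.
move=> lt_in eE qF mu0 gE; apply: accepts_event eE _ _ _ gE _ => // mu'0.
apply: accepts_sink => //.
- by move=> a; apply: (@letter_edge_mem a a 1).
- by apply: silent_mem; rewrite !inE eqxx !orbT.
- by apply/eqP => /at_inj.
- by apply/eqP => /at_inj.
exact: (@monotone_drop i.+1).
Qed.

(** Acceptance of what is left from a given event on, assuming only the clock values that matter:
    [y] is absolute time in [Wait], [x] is the time since event [i] elsewhere, and in [Two] the
    clock [y] is the time since event [i.+1]. The next lemmas chain backwards from a violation to
    [Wait]. *)
Let AccW i := forall mu, nonneg mu -> mu y = prev i ->
  accepts public Wait mu (prev i) (drop i w).
Let AccS i := forall mu, nonneg mu -> mu x = 0 ->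
  accepts public (Succ (lt i)) mu (prev i.+1) (drop i.+1 w).
Let AccC i j := forall mu, nonneg mu -> mu x = prev j - tm i ->
  accepts public (Copy (lt i)) mu (prev j) (drop j w).
Let AccT i j := forall mu, nonneg mu -> mu x = prev j - tm i ->
  mu y = prev j - tm i.+1 -> accepts public Two mu (prev j) (drop j w).

Lemma AccW_wait i : (i < n)%N -> AccW i.+1 -> AccW i.
Proof.
move=> lt_in acc mu mu0 muy.
apply: (accepts_event lt_in (@letter_edge_mem (lt i) ord0 2 isT)) => // mu'0.
by apply: acc => //; rewrite !ffunE inE muy /=; lra.
Qed.

Lemma AccS_wait i : (i < n)%N -> AccS i -> AccW i.
Proof.
move=> lt_in acc mu mu0 muy.
apply: (accepts_event lt_in (@letter_edge_mem (lt i) ord0 7 isT)) => // mu'0.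
by apply: acc => //; rewrite !ffunE inE eqxx.
Qed.

Lemma AccC_wait i : (i < n)%N -> AccC i i.+1 -> AccW i.
Proof.
move=> lt_in acc mu mu0 muy.
apply: (accepts_event lt_in (@letter_edge_mem (lt i) ord0 8 isT)) => // mu'0.
by apply: acc => //; rewrite !ffunE inE eqxx subrr.
Qed.

Lemma AccC_loop i j : (j < n)%N -> tm j < tm i + 1 -> AccC i j.+1 -> AccC i j.
Proof.
move=> lt_jn ji acc mu mu0 mux.
apply: (accepts_event lt_jn (@letter_edge_mem (lt i) (lt j) 13 isT)) => //.
  by rewrite /= ffunE mux andbT; lra.
by move=> mu'0; apply: acc => //; rewrite !ffunE inE mux /=; lra.
Qed.

Lemma AccT_succ i : (i.+1 < n)%N -> AccT i i.+2 -> AccS i.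
Proof.
move=> lt_in acc mu mu0 mux.
apply: (accepts_event lt_in (@letter_edge_mem (lt i) (lt i.+1) 12 isT)) => // mu'0.
apply: acc => //; rewrite !ffunE inE ?eqxx ?(negbTE xy) ?mux /=; lra.
Qed.

Lemma AccT_loop i j : (j < n)%N -> AccT i j.+1 -> AccT i j.
Proof.
move=> lt_jn acc mu mu0 mux muy.
apply: (accepts_event lt_jn (@letter_edge_mem (lt j) ord0 9 isT)) => // mu'0.
by apply: acc => //; rewrite !ffunE inE ?mux ?muy /=; lra.
Qed.

Lemma AccT_violation i j : (i.+1 < j < n)%N -> tm i + 1 < tm j ->
  tm j < tm i.+1 + 1 -> AccW i.
Proof.
move=> /andP[ij jn] tij tji; apply: AccS_wait; first lia.
apply: AccT_succ; first lia.
have : AccT i j.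
  move=> mu mu0 mux muy.
  apply: (accepts_violation jn (@letter_edge_mem (lt j) ord0 10 isT)) => //=.
  by rewrite !ffunE mux muy andbT; apply/andP; split; lra.
(* Backwards through the [d] events that are read in [Two] before [j]. *)
have [d jE] : exists d, j = (i.+2 + d)%N by exists (j - i.+2)%N; lia.
elim: d j jE {tij tji ij} jn => [|d IHd] j jE jn acc; first by rewrite jE addn0 in acc.
have ej : j = (i.+2 + d).+1 by lia.
rewrite ej in acc jn; apply: (IHd (i.+2 + d)%N) => //; first lia.
by apply: AccT_loop; first lia.
Qed.

(** The events between [i] and [j] satisfy the guard of the loop on [Copy], so the run can wait
    there for [j]. *)
Lemma AccC_violation i j : (i < j < n)%N ->
  (forall i', (i < i' < j)%N -> tm i' < tm i + 1) ->
  (tm i + 1 < tm j) || (tm j == tm i + 1) && ~~ copy (lt i) (lt j) -> AccW i.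
Proof.
move=> /andP[ij jn] mid vij; apply: AccC_wait; first lia.
have : AccC i j.
  move=> mu mu0 mux.
  apply: (accepts_violation jn (@letter_edge_mem (lt i) (lt j) 14 isT)) => //=.
  rewrite !ffunE mux andbT; case/orP: vij => [vij|/andP[/eqP vij /negbTE->]] /=.
    by case: ifP => _ /=; lra.
  by lra.
have [d jE] : exists d, j = (i.+1 + d)%N by exists (j - i.+1)%N; lia.
elim: d j jE {vij ij} jn mid => [|d IHd] j jE jn mid acc.
  by rewrite jE addn0 in acc.
have ej : j = (i.+1 + d).+1 by lia.
rewrite ej in acc jn mid; apply: (IHd (i.+1 + d)%N) => //; first lia.
  by move=> i' ii'; apply: mid; lia.
by apply: AccC_loop => //; [lia|apply: mid; lia].
Qed.

Lemma AccS_violation i : (i.+1 < n)%N ->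
  (tm i.+1 == tm i) || ~~ succ (lt i) (lt i.+1) -> AccW i.
Proof.
move=> lt_in vi; apply: AccS_wait; first lia.
move=> mu mu0 mux.
apply: (accepts_violation lt_in (@letter_edge_mem (lt i) (lt i.+1) 11 isT)) => //=.
case/orP: vi => [/eqP vi|/negbTE->//]; case: ifP => //= _.
by rewrite ffunE mux vi /= subrr addr0 eqxx.
Qed.

Lemma AccW_accepts i : (i <= n)%N -> AccW i -> accepts public Init val0 0 w.
Proof.
elim: i => [|i IHi] lt_in acc; last by apply: IHi (AccW_wait _ _) => //; exact: ltnW.
have := acc val0 nonneg0; rewrite ffunE drop0 => /(_ erefl).
apply: accepts_silent => //; last exact: nonneg0.
  by apply: silent_mem; rewrite !inE eqxx !orbT.
by apply/eqP => /at_inj.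
Qed.

Lemma AccW_final : (0 < n)%N -> ~~ final (lt n.-1) -> AccW n.-1.
Proof.
move=> n_gt0 fn mu mu0 muy.
apply: (accepts_event _ (@letter_edge_mem (lt n.-1) ord0 3 isT)) => //.
- by lia.
- by rewrite (negbTE fn).
rewrite (negbTE fn) prednK // drop_size => _; exact: accepts_fin.
Qed.

Definition phase_okR c (t : R) : bool :=
  match c with
  | 0 => t < 1
  | 1 => 1 <= t < z%:R
  | _ => z%:R <= t
  end.

Lemma AccW_phase i : (i < n)%N -> ~~ phase_okR (kind (lt i)) (tm i) -> AccW i.
Proof.
move=> lt_in vi mu mu0 muy.
have [vl|/negbTE vl] := boolP (sat (val_delay mu (tm i - prev i)) (low_guard (kind (lt i)))).
  exact: (accepts_violation lt_in (@letter_edge_mem (lt i) ord0 4 isT)).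
apply: (accepts_violation lt_in (@letter_edge_mem (lt i) ord0 5 isT)) => //.
move: vl vi; rewrite /low_guard /high_guard.
case: (kind (lt i)) => [|[|c]] /=; rewrite !ffunE muy !andbT addrC subrK.
- by move=> _; rewrite -leNgt.
- by move/negbT; rewrite -leNgt => -> /=; rewrite -leNgt.
- by move/negbT; rewrite -leNgt => ->.
Qed.

(** Rejection rules out every violation. Hence times increase strictly, events recur after exactly
    one time unit with nothing in between, and the rows are the unit intervals. *)
Lemma rejected_tileable : ~ accepts public Init val0 0 w ->
  tileable (fun a b : 'I_m.+1 => succ a b) (fun a b : 'I_m.+1 => copy a b)
    (fun a : 'I_m.+1 => kind a) (fun a : 'I_m.+1 => start a)
    (fun a : 'I_m.+1 => final a) z.
Proof.
move=> rej.
have rejW i : (i <= n)%N -> ~ AccW i by move=> le_in /(AccW_accepts le_in).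
have n_gt0 : (0 < n)%N.
  rewrite lt0n; apply/eqP => /size0nil w0; apply: rej; rewrite w0.
  apply: accepts_silent (accepts_fin _ _ _) => //; last exact: nonneg0.
    by apply: silent_mem; rewrite !inE eqxx !orbT.
  by apply/eqP => /at_inj.
have [start0 tm0] : start (lt 0) /\ tm 0 = 0.
  have rej0 := @accepts_violation _ _ _ val0 0 n_gt0
    (@letter_edge_mem (lt 0) ord0 6 isT) _ nonneg0.
  case: (boolP (start (lt 0))) rej0 => st /= rej0; last first.
    by case: rej; rewrite -[w]drop0; apply: rej0.
  split=> //; apply/eqP; rewrite eq_le [0 <= _](prev_le n_gt0) andbT leNgt.
  apply/negP => t0.
  case: rej; rewrite -[w]drop0; apply: rej0 => //.
  by rewrite /= !ffunE; lra.
have succ_ok i : (i.+1 < n)%N -> succ (lt i) (lt i.+1).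
  move=> lt_in; apply/negPn/negP => vi; apply: (@rejW i); first lia.
  by apply: AccS_violation => //; rewrite vi orbT.
have tm_lt i j : (i < j < n)%N -> tm i < tm j.
  elim: j => // j IHj /andP[ij jn]; have := @prev_le j.+1 jn => /= tj.
  have {}tj : tm j < tm j.+1.
    rewrite lt_neqAle tj andbT eq_sym; apply/negP => vj.
    by apply: (@rejW j); [lia|apply: AccS_violation => //; rewrite vj].
  by case: (eqVneq i j) => [->//|nij]; apply: lt_trans tj; apply: IHj; lia.
have copy_ok i j : (i < j < n)%N ->
    (forall i', (i < i' < j)%N -> tm i' < tm i + 1) -> tm i + 1 <= tm j ->
    tm j = tm i + 1 /\ copy (lt i) (lt j).
  move=> ij mid tij; have [] := (AccC_violation ij mid, @rejW i) => [vij rij].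
  have in_ : (i <= n)%N by lia.
  have E : tm j = tm i + 1.
    apply/eqP; rewrite eq_le tij andbT leNgt; apply/negP => tij'.
    by apply: rij => //; apply: vij; rewrite tij'.
  split=> //; apply/negPn/negP => cij; apply: rij => //; apply: vij.
  by rewrite E eqxx cij orbT.
have two_ok i j : (i.+1 < j < n)%N -> tm i + 1 < tm j -> tm i.+1 + 1 <= tm j.
  move=> ij tij; rewrite leNgt; apply/negP => tji; apply: (@rejW i); first lia.
  exact: AccT_violation ij tij tji.
(* The row length is the number of events before time 1. *)
pose p := find (fun t => 1 <= t) (map snd w).
have p_le : (p <= n)%N by rewrite /p /n -(size_map snd) find_size.
have lt_p i : (i < p)%N -> tm i < 1.
  move=> ip; have := before_find 0 ip; rewrite (nth_map (ord0, 0)); last first.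
    exact: leq_trans ip p_le.
  by move/negbT; rewrite -ltNge.
have ge_p : (p < n)%N -> 1 <= tm p.
  move=> pn; have := @nth_find _ 0 (fun t => 1 <= t) (map snd w).
  by rewrite has_find size_map => /(_ pn); rewrite (nth_map (ord0, 0)).
have p_gt0 : (0 < p)%N.
  rewrite lt0n; apply/eqP => p0; have := ge_p; rewrite p0 => /(_ n_gt0).
  by rewrite tm0; lra.
(* If event [i + p] is the copy of [i], then the next event cannot come before the time of the copy
   of [i.+1], so it is the first at distance at least one from [i.+1], and [copy_ok] applies. *)
have shift i : (i + p < n)%N -> tm (i + p)%N = tm i + 1 /\ copy (lt i) (lt (i + p)%N).
  elim: i => [|i IHi] ip.
    apply: copy_ok; rewrite ?tm0 ?add0r //; first lia.
      by move=> i' i'p; apply: lt_p; lia.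
    exact: ge_p.
  have [|Ei _] := IHi; first lia.
  apply: copy_ok; first lia.
    move=> i' i'p; have Ti : tm i < tm i.+1 by apply: tm_lt; lia.
    have : tm i' <= tm (i + p)%N.
      by case: (eqVneq i' (i + p)%N) => [->//|ne]; apply/ltW/tm_lt; lia.
    by rewrite Ei; lra.
  by apply: two_ok; [lia|rewrite -Ei; apply: tm_lt; lia].
(* As [tm j] is below 1, the row index is the integer part of the time. *)
have row d j : (j < p)%N -> (d * p + j < n)%N -> tm (d * p + j)%N = tm j + d%:R.
  elim: d => [|d IHd] jp dn; first by rewrite addr0.
  have -> : (d.+1 * p + j = d * p + j + p)%N by lia.
  have [|-> _] := shift (d * p + j)%N; first lia.
  by rewrite IHd ?natrS ?addrA //; [rewrite -natr1 addrA|lia].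
(* The bound of a tiling is its last index, hence [n.-1] for [n] events. *)
exists p, n.-1, lt; split=> //=.
- by rewrite p_gt0.
- by move=> i ni; apply: succ_ok; lia.
- by move=> i ni; apply: (shift i _).2; lia.
- move=> i ni; have {}ni : (i < n)%N by lia.
  have : phase_okR (kind (lt i)) (tm i).
    by apply/negPn/negP => vi; apply: (@rejW i); [lia|apply: AccW_phase].
  have jp := ltn_pmod i p_gt0; move: (i %/ p)%N (i %% p)%N (divn_eq i p) jp.
  move=> d j Ei jp; rewrite Ei row -?Ei //.
  have t0 : 0 <= tm j.
    case: (posnP j) => [->|j_gt0]; first by rewrite tm0.
    by rewrite -tm0; apply/ltW/tm_lt; lia.
  have t1 := lt_p j jp.
  case: (kind _) => [|[|c]] /=.
  + by move=> h; rewrite -(ltr_nat R); lra.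
  + case/andP => h1 h2; apply/andP; split; last by rewrite -(ltr_nat R); lra.
    by rewrite lt0n; apply/eqP => d0; rewrite d0 in h1; lra.
  + by move=> h; rewrite -ltnS -(ltr_nat R) -natr1; lra.
- by apply/negPn/negP => vf; apply: (@rejW n.-1); [lia|apply: AccW_final].
Qed.

End Violations.

(** * Tilings yield words without violations *)

Section Rejection.

Variables (p n : nat) (l : nat -> 'I_m.+1).
Hypothesis l_tiling :
  tiling (fun a b : 'I_m.+1 => succ a b) (fun a b : 'I_m.+1 => copy a b)
    (fun a : 'I_m.+1 => kind a) (fun a : 'I_m.+1 => start a)
    (fun a : 'I_m.+1 => final a) z p n l.

(** Events are equally spaced, with one row per time unit. *)
Let T i : R := i%:R / p%:R.
Let w : word := mkseq (fun i => (l i, T i)) n.+1.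

Let p_gt0 : (0 < p)%N.
Proof. by case: l_tiling => /andP[]. Qed.

Let p_gt0R : 0 < p%:R :> R.
Proof. by rewrite ltr0n p_gt0. Qed.

Lemma event_lt i j : (T i < T j) = (i < j)%N.
Proof. by rewrite ltr_pM2r ?invr_gt0 // ltr_nat. Qed.

Lemma event_shift i : T i + 1 = T (i + p).
Proof. by rewrite /T natrD mulrDl divff // gt_eqF. Qed.

Lemma event_row i c : (T i < c%:R) = (i %/ p < c)%N.
Proof. by rewrite ltr_pdivrMr // -natrM ltr_nat ltn_divLR. Qed.

Lemma event_phase i c : phase_ok z c (i %/ p) -> phase_okR c (T i).
Proof.
case: c => [|[|c]] /=.
- by rewrite (event_row i 1).
- by move=> /andP[d1 dz]; rewrite event_row dz leNgt (event_row i 1) -leqNgt d1.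
- by rewrite leNgt event_row -leqNgt.
Qed.

Lemma tiling_monotone : monotone 0 w.
Proof.
rewrite /monotone /w -map_comp -[map _ _]/(mkseq T n.+1); apply/(pathP 0) => i.
rewrite size_mkseq => lt_in; rewrite nth_mkseq //.
case: i lt_in => [|i] lt_in; first by rewrite /= /T mul0r.
have -> : nth 0 (0 :: mkseq T n.+1) i.+1 = T i by rewrite -(nth_mkseq 0 T (ltnW lt_in)).
by apply: ltW; rewrite event_lt.
Qed.

(** Invariant of a public run at time [t] that has read the first [i] events of [w]. It excludes
    [Acc], and in [Fin] one of the [n.+1] events is still unread, so no run reads all of [w]. *)
Definition run_inv q (mu : cval) (t : R) i : Prop :=
  match q with
  | Init => i = 0%N /\ mu y = t
  | Priv | Acc => False
  | Fin => (i <= n)%N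
  | Wait => mu y = t
  | Succ a => exists j, [/\ i = j.+1, a = l j & mu x = t - T j]
  | Copy a => exists j, [/\ a = l j, mu x = t - T j
                          & forall i', (i' < i)%N -> T i' < T j + 1]
  | Two => exists j, mu x = t - T j /\ mu y = t - T j.+1
  end.

Lemma run_inv_reject s q (mu : cval) t i : run_inv q mu t i ->
  run_from checker (at_ q, mu) s ->
  all (fun st : run_step => public st.2.1) s -> trace_from t s <> drop i w.
Proof.
have [/andP[_ l_start] l_succ l_copy l_kind l_final] := l_tiling.
elim: s q mu t i => [|[[d e] c'] s IHs] q mu t i I.
  rewrite /= inE => /eqP/at_inj qF _ /(congr1 size).
  by move: I; rewrite qF /= size_drop size_mkseq; lia.
move=> [_ [c1 [d0 _ ->] [eE src gE c'E _]] rs] /andP[pc' ps] tE.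
(* It remains to check edge by edge that the invariant is kept or that the guard contradicts the
   tiling. *)
have silent_step q0 q1 : e = tr q0 [::] None finset.set0 q1 ->
    (q0 = q -> q1 <> Priv ->
     run_inv q1 (val_reset (val_delay mu d) finset.set0) (t + d) i) -> False.
  move=> Ee; move: src c'E tE; rewrite Ee /= => /at_inj q0q c'E tE I'.
  rewrite c'E in rs pc'; apply: (IHs _ _ _ _ (I' q0q _) rs ps tE).
  by move=> q1P; rewrite q1P eqxx in pc'.
have letter_step q0 g a r q1 : e = tr q0 g (Some a) r q1 ->
    (q0 = q -> a = l i -> (i <= n)%N -> t + d = T i ->
     sat (val_delay mu d) g -> q1 <> Priv ->
     run_inv q1 (val_reset (val_delay mu d) r) (T i) i.+1) -> False.
  move=> Ee; move: src gE c'E tE; rewrite Ee /= => /at_inj q0q gE c'E tE I'.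
  have le_in : (i <= n)%N.
    rewrite leqNgt; apply/negP => ni.
    by move: tE; rewrite drop_oversize // size_mkseq.
  move: tE; rewrite (drop_nth (ord0, 0)) ?size_mkseq // nth_mkseq //.
  move=> -[aE tE sE]; rewrite c'E tE in rs pc' sE.
  apply: (IHs _ _ _ _ (I' q0q aE le_in tE gE _) rs ps sE).
  by move=> q1P; rewrite q1P eqxx in pc'.
case: (all_edgesP eE) => [|[a [b]]]; rewrite !inE.
  case/or4P => [/eqP||/eqP|/orP[]/eqP].
  - by move/silent_step; apply.
  - by move/eqP/silent_step; apply=> qE _; move: I; rewrite -qE /= !ffunE inE => -[_ ->].
  - by move/silent_step; apply=> qE _; move: I; rewrite -qE => -[->].
  - by move/silent_step; apply=> qE _; move: I; rewrite -qE.
  - by move/silent_step; apply=> qE _; move: I; rewrite -qE.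
case/predU1P => [/letter_step|].
  by apply.
case/predU1P => [/letter_step|].
  by apply=> qE; move: I; rewrite -qE.
case/predU1P => [/letter_step|].
  by apply=> qE _ _ tE' _ _; move: I; rewrite -qE /= !ffunE inE => ->.
case/predU1P => [/letter_step|].
  apply=> qE aE le_in tE' _ _; move: I; rewrite -qE aE /=.
  case: ifP => [_|/negbT nf _] /=; first by rewrite !ffunE inE => ->.
  by rewrite ltn_neqAle le_in andbT; apply: contraNneq nf => ->.
case/predU1P => [/letter_step|].
  apply=> qE aE le_in tE' + _; move: I (event_phase (l_kind i le_in)).
  rewrite -qE aE /= => muy; rewrite ffunE muy tE' andbT.
  case: (kind _) => [|[|c]] /=.
  - by move=> _; rewrite ltNge divr_ge0 ?ler0n.
  - by case/andP => h _; rewrite ltNge h.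
  - by move=> h; rewrite ltNge h.
case/predU1P => [/letter_step|].
  apply=> qE aE le_in tE' + _; move: I (event_phase (l_kind i le_in)).
  rewrite -qE aE /high_guard /= => muy.
  case: (kind _) => [|[|c]] /=; rewrite ffunE muy tE' andbT.
  - by move=> h; rewrite leNgt h.
  - by case/andP => _ h; rewrite leNgt h.
  - by move=> _; rewrite ltNge divr_ge0 ?ler0n.
case/predU1P => [/letter_step|].
  apply=> qE aE le_in tE' + _; move: I tE' aE; rewrite -qE => -[-> muy] tE' ->.
  by rewrite l_start /= ffunE muy tE' /T mul0r ltxx.
case/predU1P => [/letter_step|].
  by apply=> qE aE *; exists i; rewrite !ffunE inE eqxx subrr.
case/predU1P => [/letter_step|].
  apply=> qE aE *; exists i; rewrite !ffunE inE eqxx subrr; split=> // i'.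
  by move=> ii'; rewrite event_shift event_lt -addn1 leq_add.
case/predU1P => [/letter_step|].
  apply=> qE _ _ tE' _ _; move: I; rewrite -qE => -[j [mux muy]].
  by exists j; rewrite !ffunE !inE mux muy; split; lra.
case/predU1P => [/letter_step|].
  apply=> qE _ _ tE' + _; move: I; rewrite -qE => -[j [mux muy]].
  rewrite /= !ffunE mux muy andbT => /andP[h1 h2].
  (* The guard would put an event strictly between the adjacent cells [j + p] and [j.+1 + p]. *)
  have : T (j + p) < T i by rewrite -event_shift; lra.
  have : T i < T (j.+1 + p) by rewrite -event_shift; lra.
  by rewrite !event_lt addSn ltnS leqNgt => /negP.
case/predU1P => [/letter_step|].
  apply=> qE bE le_in tE' + _; move: I; rewrite -qE => -[j [iE aE mux]].
  rewrite iE in le_in tE' bE *.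
  rewrite aE bE l_succ //= ffunE mux andbT => /eqP h.
  have : T j < T j.+1 by rewrite event_lt.
  by lra.
case/predU1P => [/letter_step|].
  apply=> qE _ _ tE' _ _; move: I; rewrite -qE => -[j [iE _ mux]].
  exists j; rewrite !ffunE !inE (negbTE xy) eqxx mux -iE.
  by split; lra.
case/predU1P => [/letter_step|].
  apply=> qE _ _ tE' + _; move: I; rewrite -qE => -[j [aE mux lt_j]].
  rewrite /= ffunE mux andbT => h; exists j; rewrite !ffunE inE mux; split=> //.
    by lra.
  move=> i'; rewrite ltnS leq_eqVlt => /predU1P[->|]; last exact: lt_j.
  by lra.
move=> /eqP/letter_step.
apply=> qE bE le_in tE' + _; move: I; rewrite -qE => -[j [aE mux lt_j]].
rewrite /= ffunE mux andbT => h.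
have le_Tj : T (j + p) <= T i.
  by rewrite -event_shift; move: h; case: ifP => _ /=; lra.
have le_ij : (i <= j + p)%N.
  by rewrite leqNgt; apply/negP => /lt_j; rewrite event_shift ltxx.
(* All earlier events are less than one unit after [j], so the event leaving [Copy] is the cell
   below [j]. It is a correct copy at distance exactly one, and the strict guard fails. *)
have iE : i = (j + p)%N.
  by apply/eqP; rewrite eqn_leq le_ij leqNgt -event_lt -leNgt.
move: h; rewrite aE bE iE l_copy -?iE //= -addrA => h.
by have := event_shift j; rewrite -iE; lra.
Qed.

Lemma tiling_rejected : ~ accepts public Init val0 0 w.
Proof.
move=> [s [rs ps]]; rewrite -[w]drop0; apply: (run_inv_reject _ rs ps).
by split; rewrite ?ffunE.
Qed.

End Rejection.

Lemma universal_checker :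
  (forall w, monotone 0 w -> @PubTr R _ _ _ checker w) <->
  ~ tileable (fun a b : 'I_m.+1 => succ a b) (fun a b : 'I_m.+1 => copy a b)
    (fun a : 'I_m.+1 => kind a) (fun a : 'I_m.+1 => start a)
    (fun a : 'I_m.+1 => final a) z.
Proof.
split=> [univ [p [n [l l_tiling]]]|not_tile w w_mono].
  apply: (tiling_rejected l_tiling).
  by apply/pub_traceP; apply: univ; apply: tiling_monotone l_tiling.
apply/pub_traceP; apply: contrapT => rej.
exact: not_tile (rejected_tileable w_mono rej).
Qed.

End Automaton.

(** * Computing the code of the automaton *)

Local Arguments CodeSeq.code : simpl never.

(** A list code is built from its last entry, so round [j] of the iteration handles index
    [n - j.+1]. *)
Lemma foldr_iota (T : Type) (f : nat -> T -> T) z n :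
  foldr f z (iota 0 n) = iteri n (fun j => f (n - j.+1)) z.
Proof.
suff gen j : j <= n -> foldr f z (iota (n - j) j) = iteri j (fun j => f (n - j.+1)) z.
  by rewrite -gen // subnn.
elim: j => //= j IHj lt_jn; rewrite -IHj; last exact: ltnW.
by rewrite -subSn.
Qed.

Notation code_cons := (fun a c : nat => 2 ^ a * c.*2.+1)%N.

Lemma code_flatten (E : nat -> seq nat) n :
  CodeSeq.code (flatten [seq E i | i <- iota 0 n]) =
  iteri n (fun j c => foldr code_cons c (E (n - j.+1))) 0.
Proof.
rewrite -(foldr_iota (fun i c => foldr code_cons c (E i)) 0) /CodeSeq.code.
by elim: (iota 0 n) => //= i s IHs; rewrite foldr_cat IHs.
Qed.

Lemma code_set1 n (i : 'I_n) : code_set [set i]%SET = CodeSeq.code [:: val i].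
Proof. by rewrite /code_set enum_set1. Qed.

Section Instances.

Variables (k : nat) (x y : 'I_k).

(* Numbers are read as [:: m; S; C; K; I; F]: there are [m.+1] letters, and the
   other components are codes of the tables of the tile system. *)
Definition nlet (X : nat) : nat := (code_nth X 0).+1.
Definition xsucc (X a b : nat) : bool :=
  code_nth (code_nth X 1) (a * nlet X + b) != 0.
Definition xcopy (X a b : nat) : bool :=
  code_nth (code_nth X 2) (a * nlet X + b) != 0.
Definition xkind (X a : nat) : nat := code_nth (code_nth X 3) a.
Definition xstart (X a : nat) : bool := code_nth (code_nth X 4) a != 0.
Definition xfinal (X a : nat) : bool := code_nth (code_nth X 5) a != 0.

(** The diagonal: [X] is both the table and the number of preamble rows. *)
Definition xtileable (X : nat) : Prop :=
  tileable (fun a b : 'I_(nlet X) => xsucc X a b)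
    (fun a b : 'I_(nlet X) => xcopy X a b) (fun a : 'I_(nlet X) => xkind X a)
    (fun a : 'I_(nlet X) => xstart X a) (fun a : 'I_(nlet X) => xfinal X a) X.

Definition xchecker (X : nat) : ta_instance k :=
  TAInstance (checker x y (code_nth X 0) (xsucc X) (xcopy X) (xkind X)
                (xstart X) (xfinal X) X).

Definition ecode l g a r l' : nat := CodeSeq.code [:: l; g; a; r; l'].

Definition gcode (c : 'I_k) o d : nat := CodeSeq.code [:: code_constraint (c, o, Posz d)].

(** Mirrors [letter_edges] on numbers alone: 0 codes the empty guard, locations are given by
    [loc_nat], and codes of clock sets are constants. *)
Definition letter_codes (X i : nat) : seq nat :=
  let: a := (i %/ nlet X)%N in let: b := (i %% nlet X)%N in
  let: none := code_set (finset.set0 : {set 'I_k}) in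
  let: rx := code_set [set x]%SET in let: ry := code_set [set y]%SET in
  [:: ecode 1 0 a.+1 none 1;
      ecode 3 0 a.+1 none 3;
      ecode 4 0 a.+1 none 4;
      ecode 4 0 a.+1 none (if xfinal X a then 4 else 2);
      ecode 4 (gcode y CmpLt (if xkind X a == 0 then 0 else
                              if xkind X a == 1 then 1 else X)) a.+1 none 3;
      ecode 4 (if xkind X a == 0 then gcode y CmpGe 1 else
               if xkind X a == 1 then gcode y CmpGe X else gcode y CmpLt 0)
        a.+1 none 3;
      ecode 0 (if xstart X a then gcode y CmpGt 0 else 0) a.+1 none 3;
      ecode 4 0 a.+1 rx (6 + a);
      ecode 4 0 a.+1 rx (6 + nlet X + a);
      ecode 5 0 a.+1 none 5;
      ecode 5 (code_guard [:: (x, CmpGt, Posz 1); (y, CmpLt, Posz 1)])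
        a.+1 none 3;
      ecode (6 + a) (if xsucc X a b then gcode x CmpEq 0 else 0) b.+1 none 3;
      ecode (6 + a) 0 b.+1 ry 5;
      ecode (6 + nlet X + a) (gcode x CmpLt 1) b.+1 none (6 + nlet X + a);
      ecode (6 + nlet X + a)
        (if xcopy X a b then gcode x CmpGt 1 else gcode x CmpGe 1) b.+1 none 3].

Lemma code_tr m q g (a : option 'I_m.+1) r q' :
  code_edge (tr q g a r q') =
  ecode (loc_nat q) (@code_guard k g) (code_act a) (code_set r) (loc_nat q').
Proof. by rewrite -!at_K. Qed.

Lemma letter_codesE X i : i < nlet X * nlet X ->
  map (@code_edge _ _ _) (letter_edges x y (xsucc X) (xcopy X) (xkind X)
    (xstart X) (xfinal X) X (inord (i %/ nlet X) : 'I_(code_nth X 0).+1)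
    (inord (i %% nlet X))) = letter_codes X i.
Proof.
move=> ilt; have alt : i %/ nlet X < nlet X by rewrite ltn_divLR.
have blt : i %% nlet X < nlet X by rewrite ltn_pmod.
rewrite /letter_edges /letter_codes !map_cons !code_tr ![loc_nat _]/= ![code_act _]/=.
rewrite !(inordK alt) !(inordK blt).
congr [:: _; _; _; _; _; _; _; _; _; _; _; _; _; _; _]; congr ecode;
  rewrite //= /low_guard /high_guard ?(inordK alt) //; by repeat case: ifP => _.
Qed.

Definition silent_codes : seq nat :=
  let: none := code_set (finset.set0 : {set 'I_k}) in
  [:: ecode 0 0 0 none 1; ecode 0 0 0 none 4; ecode 0 0 0 none 2;
      ecode 1 0 0 none 2; ecode 3 0 0 none 2].

Lemma silent_codesE m :
  map (@code_edge _ _ _) (silent_edges k m) = silent_codes.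
Proof. by rewrite /silent_edges /silent_codes !map_cons !code_tr. Qed.

Definition checker_code (X : nat) : nat :=
  CodeSeq.code [:: nlet X; (nlet X + nlet X).+4.+2; k; 0;
    CodeSeq.code [:: 1]; CodeSeq.code [:: 2];
    iteri (nlet X + nlet X).+4.+2 (fun _ c => code_cons 0 c) 0;
    foldr code_cons
      (iteri (nlet X * nlet X)
         (fun j c => foldr code_cons c (letter_codes X (nlet X * nlet X - j.+1)))
         0)
      silent_codes].

Lemma checker_codeE X : code_ta (xchecker X) = checker_code X.
Proof.
rewrite /code_ta /checker_code; congr (CodeSeq.code [:: _; _; _; _; _; _; _; _]).
- by rewrite /= at_K.
- by rewrite /= code_set1 /= at_K.
- by rewrite /= code_set1 /= at_K.
- transitivity (CodeSeq.code (nseq (nlet X + nlet X).+4.+2 0)).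
    congr CodeSeq.code; apply: (@eq_from_nth _ 0).
      by rewrite size_map size_enum_ord size_nseq.
    move=> i; rewrite size_map => ilt.
    have i0 : 'I_(ta_nloc (xchecker X)) by exact: ord0.
    rewrite (nth_map i0) // nth_nseq /= ffunE.
    by case: ifP.
  by elim: (_.+4.+2) => //= n <-.
transitivity (CodeSeq.code (silent_codes ++
    flatten [seq letter_codes X i | i <- iota 0 (nlet X * nlet X)])).
  congr CodeSeq.code; rewrite -(silent_codesE (code_nth X 0)).
  apply: (etrans (map_cat _ _ _)); congr (_ ++ _).
  rewrite map_flatten -map_comp; congr flatten.
  by apply/eq_in_map => i; rewrite mem_iota /= add0n => /letter_codesE <-.
by rewrite /CodeSeq.code foldr_cat -/CodeSeq.code code_flatten.
Qed.

(** * Computability of the code of the automaton *)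

Lemma computable_code n F (G : seq nat -> seq nat) : computable n F ->
  computable n (fun v => CodeSeq.code (G v)) ->
  computable n (fun v => CodeSeq.code (F v :: G v)).
Proof. exact: computable_code_cons. Qed.

Lemma computable_foldr_code n C F (G : seq nat -> seq nat) : computable n F ->
  computable n (fun v => foldr code_cons (C v) (G v)) ->
  computable n (fun v => foldr code_cons (C v) (F v :: G v)).
Proof. exact: computable_code_cons. Qed.

Ltac computability := lazymatch goal with
  | |- computable _ (fun _ => ?c) => exact: computable_const
  | |- computable _ (fun v => nth 0 v _) => exact: computable_var
  | |- computable _ (fun v => (@?F v).+1) =>
      apply: (@computable_succ _ F); computability
  | |- computable _ (fun v => (@?F v).*2) =>
      apply: (@computable_double _ F); computability
  | |- computable _ (fun v => addn (@?F v) (@?G v)) =>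
      apply: (@computable_add _ F G); computability
  | |- computable _ (fun v => subn (@?F v) (@?G v)) =>
      apply: (@computable_sub _ F G); computability
  | |- computable _ (fun v => muln (@?F v) (@?G v)) =>
      apply: (@computable_mul _ F G); computability
  | |- computable _ (fun v => divn (@?F v) (@?G v)) =>
      apply: (@computable_div _ F G); computability
  | |- computable _ (fun v => modn (@?F v) (@?G v)) =>
      apply: (@computable_mod _ F G); computability
  | |- computable _ (fun v => code_nth (@?F v) (@?G v)) =>
      apply: (@computable_code_nth _ F G); computability
  | |- computable _ (fun v => nat_of_bool (~~ @?b v)) =>
      apply: (@computable_neg _ b); computability
  | |- computable _ (fun v => nat_of_bool (@eq_op _ (@?F v) (@?G v))) =>
      apply: (@computable_eq _ F G); computability
  | |- computable _ (fun v => CodeSeq.code (@?F v :: @?G v)) =>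
      apply: (@computable_code _ F G); computability
  | |- computable _ (fun v => foldr _ (@?C v) (@?F v :: @?G v)) =>
      apply: (@computable_foldr_code _ C F G); computability
  | |- computable ?n (fun v => foldr _ (@?C v) [::]) =>
      change (computable n C); cbv beta; computability
  | |- computable _ (fun v => iteri _ _ _) => assumption
  | |- _ => apply: computable_if; computability
  end.

Lemma computable_letter_codes : computable 3 (fun v =>
  foldr code_cons (nth 0 v 1) (letter_codes (nth 0 v 2) (nth 0 v 0))).
Proof.
rewrite /letter_codes /ecode /gcode /code_constraint /code_int.
rewrite /xfinal /xkind /xstart /xsucc /xcopy /nlet.
(* These codes depend on [x] and [y] alone, hence count as constants. *)
move: (code_guard _) (code_set _) (code_set _) (code_set _) => g r1 r2 r3.
computability.
Qed.

Lemma computable_checker_code : computable 1 (fun v => checker_code (nth 0 v 0)).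
Proof.
have C1 : computable 1 (fun v =>
    iteri (nlet (nth 0 v 0) + nlet (nth 0 v 0)).+4.+2 (fun _ c => code_cons 0 c) 0).
  apply: (@computable_iteri 1
    (fun v => (nlet (nth 0 v 0) + nlet (nth 0 v 0)).+4.+2)
    (fun=> 0) (fun _ c _ => code_cons 0 c)) => //.
  - by rewrite /nlet; computability.
  - exact: computable_const.
  - by apply: computable_code_cons; computability.
have C2 : computable 1 (fun v => iteri (nlet (nth 0 v 0) * nlet (nth 0 v 0))
    (fun j c => foldr code_cons c (letter_codes (nth 0 v 0)
       (nlet (nth 0 v 0) * nlet (nth 0 v 0) - j.+1))) 0).
  apply: (@computable_iteri 1
    (fun v => nlet (nth 0 v 0) * nlet (nth 0 v 0)) (fun=> 0) (fun j c v =>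
    foldr code_cons c (letter_codes (nth 0 v 0)
       (nlet (nth 0 v 0) * nlet (nth 0 v 0) - j.+1)))) => //.
  - by rewrite /nlet; computability.
  - exact: computable_const.
  have := @computable_app 3 3 _ [:: (fun w => nlet (nth 0 w 2) * nlet (nth 0 w 2) -
    (nth 0 w 0).+1); (fun w => nth 0 w 1); (fun w => nth 0 w 2)] erefl
    computable_letter_codes.
  move=> app; apply: computable_ext (app _).
    by move=> v; rewrite nth_drop.
  by case=> [|[|[|]]] //= _; rewrite /nlet; computability.
rewrite /checker_code /silent_codes /ecode; rewrite /nlet in C1 C2 *.
move: (code_set _) => r; computability.
Qed.

End Instances.

(** * Diagonalization *)

Lemma tileable_map (T T' : Type) (f : T -> T')
    (succ copy : rel T) kind (start final : pred T)
    (succ' copy' : rel T') kind' (start' final' : pred T') z :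
  (forall a b, succ a b -> succ' (f a) (f b)) ->
  (forall a b, copy a b -> copy' (f a) (f b)) ->
  (forall a, kind' (f a) = kind a) -> (forall a, start a -> start' (f a)) ->
  (forall a, final a -> final' (f a)) ->
  @tileable T succ copy kind start final z ->
  @tileable T' succ' copy' kind' start' final' z.
Proof.
move=> fsucc fcopy fkind fstart ffinal [p [n [l [/andP[p0 l0] lS lC lK lF]]]].
exists p, n, (f \o l); split=> /=.
- by rewrite p0 fstart.
- by move=> i /lS/fsucc.
- by move=> i /lC/fcopy.
- by move=> i /lK; rewrite fkind.
- exact: ffinal.
Qed.

(** One table [X] serves for every [z], which later allows [z] to be [X] itself; positivity then
    provides the preamble with a row. *)
Lemma tables_code (T : finType) (a0 : T) (succ copy : rel T) (kind : T -> nat)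
    (start final : pred T) : exists2 X, 0 < X &
  forall z, tileable succ copy kind start final z <->
    tileable (fun a b : 'I_(nlet X) => xsucc X a b)
      (fun a b : 'I_(nlet X) => xcopy X a b) (fun a : 'I_(nlet X) => xkind X a)
      (fun a : 'I_(nlet X) => xstart X a) (fun a : 'I_(nlet X) => xfinal X a) z.
Proof.
pose M := #|T|; have M_gt0 : 0 < M by apply/card_gt0P; exists a0.
pose g i := nth a0 (enum T) i.
pose tab2 (r : rel T) := CodeSeq.code
  [seq (r (g (i %/ M)) (g (i %% M)) : nat) | i <- iota 0 (M * M)].
pose tab1 (u : T -> nat) := CodeSeq.code [seq u (g i) | i <- iota 0 M].
pose X := CodeSeq.code [:: M.-1; tab2 succ; tab2 copy; tab1 kind;
  tab1 (fun a => start a); tab1 (fun a => final a)].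
have nX : nlet X = M by rewrite /nlet code_nthE //= prednK.
have tab1E u i : i < M -> code_nth (tab1 u) i = u (g i).
  move=> iM; rewrite code_nthE; last by rewrite size_map size_iota.
  by rewrite (nth_map 0) ?size_iota // nth_iota.
have tab2E r i j : i < M -> j < M -> (code_nth (tab2 r) (i * M + j) != 0) = r (g i) (g j).
  move=> iM jM; have ijM : i * M + j < M * M by nia.
  rewrite code_nthE; last by rewrite size_map size_iota.
  rewrite (nth_map 0) ?size_iota // nth_iota // add0n.
  by rewrite divnMDl // divn_small // addn0 modnMDl modn_small //; case: (r _ _).
have lM (a : 'I_(nlet X)) : a < M by have := ltn_ord a; rewrite [X in _ < X]nX.
have succE (a b : 'I_(nlet X)) : xsucc X a b = succ (g a) (g b).
  rewrite -tab2E //; move: (val a) (val b) => i j.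
  by rewrite /xsucc nX code_nthE.
have copyE (a b : 'I_(nlet X)) : xcopy X a b = copy (g a) (g b).
  rewrite -tab2E //; move: (val a) (val b) => i j.
  by rewrite /xcopy nX code_nthE.
have kindE (a : 'I_(nlet X)) : xkind X a = kind (g a).
  by rewrite /xkind code_nthE //= tab1E.
have startE (a : 'I_(nlet X)) : xstart X a = start (g a).
  by rewrite /xstart code_nthE //= tab1E //; case: (start _).
have finalE (a : 'I_(nlet X)) : xfinal X a = final (g a).
  by rewrite /xfinal code_nthE //= tab1E //; case: (final _).
exists X; first by rewrite muln_gt0 expn_gt0.
move=> z; split.
  pose f (a : T) : 'I_(nlet X) := inord (enum_rank a).
  have fK a : g (f a) = a.
    rewrite /g inordK; first exact: nth_enum_rank.
    by rewrite -/(nlet X) nX.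
  by apply: (@tileable_map _ _ f) => [a b|a b|a|a|a];
    rewrite ?succE ?copyE ?kindE ?startE ?finalE !fK.
by apply: (@tileable_map _ _ (fun a : 'I_(nlet X) => g a)) => [a b|a b|a|a|a];
  rewrite ?succE ?copyE ?kindE ?startE ?finalE.
Qed.

Lemma instr_bound (prog : seq instr) i0 : exists2 B, 1 < B &
  forall q, let: (r1, r2, j1, j0) := nth i0 prog q in
    [/\ r1 <= B, r2 <= B, j1.+2 <= B & j0.+2 <= B].
Proof.
elim: prog => [|[[[r1 r2] j1] j0] prog [B B1 IH]].
  case: i0 => -[[r1 r2] j1] j0; exists (r1 + r2 + j1 + j0).+2 => // q.
  by rewrite nth_nil; split; lia.
exists (B + r1 + r2 + j1 + j0).+2 => // -[|q] /=; first by split; lia.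
by have := IH q; case: (nth _ _ _) => -[[? ?] ?] ? [? ? ? ?]; split; lia.
Qed.

(** The machine computes [f] into register 2 and tests it: value 1 leads to [h], value 0 to an
    endless loop. *)
Lemma recfun_machine (f : recfun 1) : exists (P : nat -> instr) (h B : nat),
  [/\ 1 < B,
      forall q, let: (r1, r2, j1, j0) := P q in
        [/\ r1 <= B, r2 <= B, j1.+2 <= B & j0.+2 <= B]
    & forall z, let halts :=
        exists k, (iter k (mstep P) (0, upd (fun=> 0) 1 z)).1 = h in
      (recfun_eval f [tuple z] 1 -> halts) /\
      (recfun_eval f [tuple z] 0 -> ~ halts)].
Proof.
pose c := rcomp f [:: 1] 2 3; pose e := csize c; pose h := e.+1.
(* The instruction at [e] repeats itself while register 2 is empty. Address [h] lies past the table,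
   where the default instruction stays at [h]. *)
pose prog := rcons (flat c 0 e) (2, 0, h, e).
pose P := nth (0, 0, h, h) prog.
have [B B1 PB] := instr_bound prog (0, 0, h, h).
exists P, h, B; split=> // z.
have Pe : P e = (2, 0, h, e) by rewrite /P /prog nth_rcons size_flat ltnn eqxx.
have Ph : P h = (0, 0, h, h) by rewrite /P nth_default // size_rcons size_flat.
have reach y : recfun_eval f [tuple z] y -> exists k s,
    iter k (mstep P) (0, upd (fun=> 0) 1 z) = (e, s) /\ s 2 = y.
  move=> fy; pose s := upd (fun=> 0) 1 z.
  have cP : exec c s (upd s 2 (s 2 + y)).
    by apply: (rcompP fy) => // -[|[|r]].
  have flatc i : i < csize c -> P (0 + i) = nth (0, 0, h, h) (flat c 0 e) i.
    by move=> ic; rewrite add0n /P /prog nth_rcons size_flat ic.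
  have [k kE] := flatP flatc cP.
  by exists k; eexists; split; [exact: kE|].
split=> [/reach[k [s [ks s2]]]|/reach[k [s [ks s2]]] [j jh]].
  by exists k.+1; rewrite iterS ks /mstep Pe /= s2.
have stay_e i : iter i (mstep P) (e, s) = (e, s).
  by elim: i => //= i ->; rewrite /mstep Pe /= s2.
have stay_h i s' : (iter i (mstep P) (h, s')).1 = h.
  by elim: i => //= i IHi; rewrite [mstep P _]/mstep IHi Ph.
(* Both [h] and [e] with register 2 empty are absorbing, so being at [h] either before or after step
   [k] is contradictory. *)
have [jk|kj] := leqP j k.
  have := congr1 fst ks; rewrite -(subnK jk) iterD.
  move: jh; case: (iter j _ _) => q s' /= ->.
  by rewrite stay_h /h; lia.
by move: jh; rewrite -(subnK (ltnW kj)) iterD ks stay_e /h /=; lia.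
Qed.

(** A decider composed with the code of [xchecker] compiles to a machine; let [X] be the table of
    its tile system. The machine halts on [X] iff [Q] holds of [xchecker x y X], iff [X] is not
    tileable, iff the machine does not halt on [X]. *)
Lemma checker_undecidable k (x y : 'I_k) (Q : ta_instance k -> Prop) :
  (forall X, Q (xchecker x y X) <-> ~ xtileable X) ->
  undecidable (@code_ta k) Q.
Proof.
move=> QX [f fQ]; have [t tE] := computable_checker_code x y.
have [P [h [B [B1 PB halt]]]] := recfun_machine (RComp f (fun=> t)).
have [X X_gt0 XE] := tables_code (mk_letter B 0 false None) (@lsucc P B)
  (@lcopy P B) (@lkind B) (@lstart B) (@lfinal h B).
have eval v : recfun_eval f [tuple code_ta (xchecker x y X)] v ->
    recfun_eval (RComp f (fun=> t)) [tuple X] v.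
  move=> fv; exists [tuple code_ta (xchecker x y X)] => // i.
  by rewrite (tnth_nth 0) ord1 checker_codeE; apply: (tE [tuple X]).
have [Q1 Q0] := fQ (xchecker x y X); have [halt1 halt0] := halt X.
have [QxX|nQ] := pselect (Q (xchecker x y X)).
  have [k' hk'] := halt1 (eval _ (Q1 QxX)).
  apply: (QX X).1 QxX _; apply: (XE X).1.
  exact: (halting_tileable X_gt0 PB B1 hk').
apply: halt0 (eval _ (Q0 nQ)) _.
apply: (tileable_halting X_gt0); apply: (XE X).2.
apply: contrapT => nX.
exact: nQ ((QX X).2 nX).
Qed.

Theorem theorem5p7 (R : realType) (k : nat) (hk : (2 <= k)%N) :
  undecidable (@code_ta k) (fun A : ta_instance k => fully_opaque R A) /\
  undecidable (@code_ta k) (fun A : ta_instance k => weakly_opaque R A).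
Proof.
(* Clocks 0 and 1; any further clock is neither tested nor reset. *)
pose x : 'I_k := Ordinal (ltnW hk); pose y : 'I_k := Ordinal hk.
have xy : x != y by [].
split; apply: (@checker_undecidable k x y) => X.
  apply: iff_trans (opaque_traces _ _ _ _ _ _ _ _ _ R).2 _.
  exact: universal_checker xy.
apply: iff_trans (opaque_traces _ _ _ _ _ _ _ _ _ R).1 _.
exact: universal_checker xy.
Qed.
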